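(* Let $\lambda$ be a non-trivial translation-invariant probability measure on the space $\mathcal M$ of meromorphic functions. Then, for $\lambda$-a.e. function $F\in\mathcal M$, \[ \liminf_{R\to\infty}\frac{T_F(R)}{R^2}>0 . \]
   Context: Meromorphic functions are treated as (holomorphic) maps of $\mathbb C$ into the Riemann sphere endowed with the spherical metric $\rho$; $\mathcal M$ is the space of all meromorphic functions on $\mathbb C$ (with $\infty$ regarded as a constant meromorphic function), with the topology of locally uniform convergence in the spherical metric and its Borel $\sigma$-algebra. $\mathbb C$ acts on $\mathcal M$ by translations $(\tau_wF)(z)=F(z+w)$. A (Borel) probability measure $\lambda$ on $\mathcal M$ is translation-invariant if it is invariant under all $\tau_w$, $w\in\mathbb C$; it is non-trivial if the set of all constant functions (including $\infty$) has $\lambda$-measure zero. The Nevanlinna characteristic in Ahlfors–Shimizu form is \[ T_F(R)=\int_0^R\Bigl(\frac1\pi\int_{|z|<r}F^{\#}(z)^2\,dA(z)\Bigr)\frac{dr}{r},\qquad F^{\#}(z)=\frac{|F'(z)|}{1+|F(z)|^2}, \] where $A$ is area (Lebesgue) measure and the spherical derivative $F^{\#}$ is extended to poles by continuity. *)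

(* Defs.v *)
From HB Require Import structures.
From mathcomp Require Import all_boot all_order all_algebra.
From mathcomp Require Import complex ring lra.
From mathcomp Require Import all_classical all_reals all_analysis.
Set Implicit Arguments.
Unset Strict Implicit.
Unset Printing Implicit Defensive.
Import Order.TTheory GRing.Theory Num.Theory.
Import numFieldNormedType.Exports.
Import ComplexField.Normc.

Local Open Scope classical_set_scope.
Local Open Scope ring_scope.
Local Open Scope complex_scope.

(* [R[i]^o] is the complex plane as a normed module over itself, so that its
   topology is the usual one and [derivable], [derive1] are complex. *)
Local Arguments normc : simpl never.

Notation plane R := (R[i]^o).

(* [None] is the point at infinity. *)
Definition riemann_sphere (R : realType) : Type := option R[i].

HB.instance Definition _ (R : realType) := Choice.on (riemann_sphere R).

Section SphericalMetric.
Variable R : realType.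
Implicit Types (p q r : riemann_sphere R) (z w : R[i]).

Definition chordal_dist p q : R :=
  match p, q with
  | Some z, Some w => normc (z - w) /
      (Num.sqrt (1 + normc z ^+ 2) * Num.sqrt (1 + normc w ^+ 2))
  | Some z, None | None, Some z => (Num.sqrt (1 + normc z ^+ 2))^-1
  | None, None => 0
  end.

(* Geodesic distance of the line element |dz| / (1 + |z|^2), which is the
   normalisation matching the spherical derivative |F'| / (1 + |F|^2). *)
Definition spherical_dist p q : R := asin (chordal_dist p q).

(* The metric axioms are checked in homogeneous coordinates. *)
Let hx p : R[i] := if p is Some z then z else 1.
Let hy p : R[i] := if p is Some _ then 1 else 0.
Let hn p : R := Num.sqrt (normc (hx p) ^+ 2 + normc (hy p) ^+ 2).
Let hdet p q : R[i] := hx p * hy q - hy p * hx q.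
Let hdot p q : R[i] := hx p * (hx q)^* + hy p * (hy q)^*.
Let cosd p q : R := normc (hdot p q) / (hn p * hn q).

Let normc_ge0 z : 0 <= normc z.
Proof. by case: z => a b; exact: sqrtr_ge0. Qed.

Let normcD z w : normc (z + w) <= normc z + normc w.
Proof. exact: (@ler_normD R (Rcomplex R)). Qed.

Let normcN z : normc (- z) = normc z.
Proof. exact: (@normrN R (Rcomplex R)). Qed.

Let normcsq z : normc z ^+ 2 = complex.Re z ^+ 2 + complex.Im z ^+ 2.
Proof. by case: z => a b; rewrite /normc /= sqr_sqrtr// addr_ge0// sqr_ge0. Qed.

Let hnsq p : hn p ^+ 2 = normc (hx p) ^+ 2 + normc (hy p) ^+ 2.
Proof. by rewrite /hn sqr_sqrtr// addr_ge0// exprn_ge0. Qed.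

Let hn_gt0 p : 0 < hn p.
Proof.
rewrite /hn sqrtr_gt0; case: p => [z|] /=.
  by rewrite normc1 expr1n ltr_wpDl// exprn_ge0.
by rewrite normc1 normc0 expr1n expr0n addr0.
Qed.

Let hn_neq0 p : hn p != 0. Proof. by rewrite gt_eqF. Qed.

Let chordalE p q : chordal_dist p q = normc (hdet p q) / (hn p * hn q).
Proof.
rewrite /hdet /hn; case: p q => [z|] [w|] /=.
- by rewrite normc1 expr1n !(addrC _ 1) mul1r mulr1.
- by rewrite normc1 normc0 mulr0 mulr1 sub0r normcN normc1 expr1n expr0n addr0
             sqrtr1 mulr1 addrC mul1r.
- by rewrite normc1 normc0 mul0r mulr1 subr0 normc1 expr1n expr0n addr0
             sqrtr1 !mul1r addrC.
- by rewrite mulr0 mul0r subrr normc0 mul0r.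
Qed.

Let lagrange p q : normc (hdet p q) ^+ 2 + normc (hdot p q) ^+ 2 =
  (hn p * hn q) ^+ 2.
Proof.
rewrite exprMn !hnsq !normcsq /hdet /hdot.
case: (hx p) (hx q) (hy p) (hy q) => [a b] [c d] [e f] [g h] /=.
by ring.
Qed.

Let chordal_ge0 p q : 0 <= chordal_dist p q.
Proof. by rewrite chordalE divr_ge0// mulr_ge0// ltW. Qed.

Let cosd_ge0 p q : 0 <= cosd p q.
Proof. by rewrite divr_ge0// mulr_ge0// ltW. Qed.

Let chordal_cosd p q : chordal_dist p q ^+ 2 + cosd p q ^+ 2 = 1.
Proof.
rewrite chordalE /cosd !expr_div_n -mulrDl lagrange divff//.
by rewrite expf_eq0/= mulf_neq0.
Qed.

Let chordal_le1 p q : chordal_dist p q <= 1.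
Proof.
rewrite -(@expr_le1 _ 2)// -(chordal_cosd p q) lerDl.
by rewrite exprn_ge0.
Qed.

Let chordal_itv p q : -1 <= chordal_dist p q <= 1.
Proof.
by rewrite chordal_le1 andbT (le_trans _ (chordal_ge0 p q))// lerN10.
Qed.

Let sin_dist p q : sin (spherical_dist p q) = chordal_dist p q.
Proof. by rewrite /spherical_dist asinK// in_itv/= chordal_itv. Qed.

Let cos_dist p q : cos (spherical_dist p q) = cosd p q.
Proof.
rewrite /spherical_dist cos_asin ?chordal_itv//.
by rewrite -(chordal_cosd p q) addrC addKr sqrtr_sqr ger0_norm.
Qed.

Let dist_le p q : spherical_dist p q <= pi / 2.
Proof. exact/asin_lepi2/chordal_itv. Qed.

Let dist_ge0 p q : 0 <= spherical_dist p q.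
Proof.
rewrite leNgt; apply/negP => d0.
have : sin (spherical_dist p q) < 0.
  rewrite -[spherical_dist p q]opprK sinN oppr_lt0 sin_gt0_pi//.
  rewrite oppr_gt0 d0/= ltrNl.
  apply: lt_le_trans (asin_geNpi2 (chordal_itv p q)).
  by rewrite ltrN2 ltr_pdivrMr// ltr_pMr ?pi_gt0// ltr1n.
by rewrite sin_dist ltNge chordal_ge0.
Qed.

Let spherical_distxx p : spherical_dist p p = 0.
Proof.
rewrite /spherical_dist chordalE /hdet [hy p * _]mulrC subrr normc0 mul0r.
rewrite -[X in asin X](@sin0 R) sinK// in_itv/= oppr_le0.
by rewrite divr_ge0// pi_ge0.
Qed.

Let spherical_dist_eq0 p q : spherical_dist p q = 0 -> p = q.
Proof.
move=> /(congr1 sin); rewrite sin_dist sin0 chordalE => /eqP.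
rewrite mulf_eq0 invr_eq0 mulf_eq0 !(negbTE (hn_neq0 _)) !orbF.
move=> /eqP/(@eq0_normc R)/eqP; rewrite /hdet subr_eq0.
case: p q => [z|] [w|] //=.
- by rewrite mulr1 mul1r => /eqP ->.
- by rewrite mulr0 mul1r eq_sym oner_eq0.
- by rewrite mul0r mulr1 oner_eq0.
Qed.

Let spherical_dist_sym p q : spherical_dist p q = spherical_dist q p.
Proof.
rewrite /spherical_dist !chordalE [hn q * _]mulrC; congr (asin (_ / _)).
by rewrite -normcN /hdet opprB [hy p * _]mulrC [hx p * _]mulrC.
Qed.

Let chordal_triangle q p r : chordal_dist p r <=
  chordal_dist p q * cosd q r + cosd p q * chordal_dist q r.
Proof.
have hdet3 : hdet p r * (hn q ^+ 2)%:C =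
    hdet p q * (hdot q r)^* + hdet q r * hdot p q.
  rewrite hnsq !normcsq /hdet /hdot.
  case: (hx p) (hx q) (hx r) (hy p) (hy q) (hy r)
    => [a b] [c d] [e f] [g h] [k l] [m n] /=.
  by apply/eqP; rewrite eq_complex; apply/andP; split; apply/eqP => /=; ring.
have normcJ z : normc z^* = normc z by case: z => a b; rewrite /normc /= sqrrN.
have normcR (x : R) : 0 <= x -> normc x%:C = x.
  by move=> x0; rewrite /normc /= expr0n addr0 sqrtr_sqr ger0_norm.
have : normc (hdet p r) * hn q ^+ 2 <=
    normc (hdet p q) * normc (hdot q r) + normc (hdet q r) * normc (hdot p q).
  rewrite -{1}(normcR (hn q ^+ 2)) ?exprn_ge0 ?(ltW (hn_gt0 q))//.
  rewrite -normcM hdet3 (le_trans (normcD _ _))// !normcM normcJ.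
  exact: lexx.
rewrite !chordalE /cosd => H.
have -> : normc (hdet p r) / (hn p * hn r) =
    (normc (hdet p r) * hn q ^+ 2) / (hn p * hn r * hn q ^+ 2).
  by field; rewrite !hn_neq0.
have -> : normc (hdet p q) / (hn p * hn q) * (normc (hdot q r) / (hn q * hn r))
    + normc (hdot p q) / (hn p * hn q) * (normc (hdet q r) / (hn q * hn r)) =
    (normc (hdet p q) * normc (hdot q r) + normc (hdet q r) * normc (hdot p q))
    / (hn p * hn r * hn q ^+ 2).
  by field; rewrite !hn_neq0.
by rewrite ler_pM2r// invr_gt0 !mulr_gt0 ?exprn_gt0.
Qed.

Let spherical_dist_triangle q p r :
  spherical_dist p r <= spherical_dist p q + spherical_dist q r.
Proof.
have [h|h] := leP (pi / 2) (spherical_dist p q + spherical_dist q r).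
  exact: le_trans (dist_le _ _) h.
rewrite leNgt; apply/negP => lt_d.
have : sin (spherical_dist p q + spherical_dist q r) < sin (spherical_dist p r).
  rewrite ltr_sin// in_itv/= ?dist_le ?andbT ?(ltW h) ?andbT.
  - by rewrite (le_trans _ (addr_ge0 (dist_ge0 p q) (dist_ge0 q r)))//
      oppr_le0 divr_ge0// pi_ge0.
  - by rewrite (le_trans _ (dist_ge0 p r))// oppr_le0 divr_ge0// pi_ge0.
by rewrite sinD !sin_dist !cos_dist ltNge chordal_triangle.
Qed.

HB.instance Definition _ := @isMetric.Build R (riemann_sphere R) spherical_dist
  spherical_distxx spherical_dist_eq0 spherical_dist_sym spherical_dist_triangle.

End SphericalMetric.

HB.instance Definition _ (R : realType) :=
  isPointed.Build (riemann_sphere R) None.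

Section Meromorphic.
Variable R : realType.
Implicit Types (F : plane R -> riemann_sphere R) (z w : plane R).

Definition finite_part (p : riemann_sphere R) : plane R :=
  if p is Some z then z else 0.

Definition sphere_inv (p : riemann_sphere R) : riemann_sphere R :=
  if p is Some z then (if z == 0 then None else Some z^-1) else Some 0.

(* Holomorphic map into the Riemann sphere, read in the two charts [w] (away
   from infinity) and [1/w] (away from 0).  The constant infinity qualifies. *)
Definition meromorphic F : Prop :=
  continuous F /\
  forall z,
    (F z <> None -> derivable (finite_part \o F) z 1) /\
    (F z <> Some 0 -> derivable (finite_part \o sphere_inv \o F) z 1).

Lemma derivable_shift (f : plane R -> plane R) w z :
  derivable f (z + w) 1 -> derivable (fun u => f (u + w)) z 1.
Proof.
rewrite /derivable => df.
suff <- : (fun h : R[i] => h^-1 *: ((f \o shift (z + w)) (h *: (1 : plane R)) -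
    f (z + w))) =
  (fun h : R[i] => h^-1 *: (((fun u => f (u + w)) \o shift z)
    (h *: (1 : plane R)) - f (z + w))) by [].
by apply/funext => h /=; rewrite addrA.
Qed.

Lemma meromorphic_shift F w : meromorphic F -> meromorphic (fun z => F (z + w)).
Proof.
move=> [cF dF]; split=> [z|z].
  apply: (@continuous_comp _ _ _ (fun u : plane R => u + w) F); last exact: cF.
  have zF : Filter (nbhs (z : plane R)) by exact: nbhs_filter.
  exact: (cvgD (@cvg_id _ _) (@cvg_cst (plane R) w _ _ zF)).
have [d0 d1] := dF (z + w); split=> [/d0|/d1]; move=> d.
  exact: (derivable_shift (f := finite_part \o F) d).
exact: (derivable_shift (f := finite_part \o sphere_inv \o F) d).
Qed.

Lemma meromorphic_infty : meromorphic (fun=> None).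
Proof.
split=> [z|z].
  exact: (@cvg_cst (riemann_sphere R) None _ _ (nbhs_filter (z : plane R))).
by split=> _; exact: (@derivable_cst _ _ _ (0 : plane R)).
Qed.

End Meromorphic.

Definition meromorphic_set (R : realType) :
    set {family compact, plane R -> riemann_sphere R} :=
  [set F | meromorphic F].
Arguments meromorphic_set : clear implicits.

(* The space of meromorphic functions, with the topology induced by uniform
   convergence on compact sets. *)
Definition merofun (R : realType) : Type := meromorphic_set R.

Section SpaceOfMeromorphicFunctions.
Variable R : realType.

HB.instance Definition _ := Topological.copy (merofun R) (meromorphic_set R).

Definition mero_eval (F : merofun R) : plane R -> riemann_sphere R := set_val F.
Coercion mero_eval : merofun >-> Funclass.

Definition mk_merofun (F : plane R -> riemann_sphere R) (mF : meromorphic F) :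
    merofun R :=
  exist (fun G => G \in meromorphic_set R) F (mem_set mF).

HB.instance Definition _ :=
  isPointed.Build (merofun R) (mk_merofun (@meromorphic_infty R)).

Definition translate (w : plane R) (F : merofun R) : merofun R :=
  mk_merofun (meromorphic_shift w (set_valP F)).

Definition borel_merofun := g_sigma_algebraType (@open (merofun R)).

HB.instance Definition _ := Measurable.on borel_merofun.

End SpaceOfMeromorphicFunctions.

Section Statement.
Variable R : realType.
Implicit Types (lambda : probability (borel_merofun R) R) (F : merofun R).

Definition translation_invariant lambda : Prop :=
  forall (w : plane R) (A : set (borel_merofun R)), measurable A ->
    lambda (translate w @^-1` A) = lambda A.

Definition non_trivial lambda : Prop :=
  lambda [set F : merofun R | exists c : riemann_sphere R, forall z, F z = c]
  = 0%E.

(* Only meaningful where F is finite. *)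
Definition finite_spherical_derivative F (z : plane R) : R :=
  normc (@derive1 R[i] (plane R) (@finite_part R \o F) z) /
  (1 + normc (finite_part (F z)) ^+ 2).

(* The limit is the continuous extension to the poles; for F constantly
   infinite it gives 0. *)
Definition spherical_derivative F (z : plane R) : R :=
  if F z == None then lim (finite_spherical_derivative F w @[w --> z^'])
  else finite_spherical_derivative F z.

Local Notation mu := (@lebesgue_measure R).

(* Ahlfors-Shimizu form; area is the product Lebesgue measure in the coordinates
   (x, y) of x + i y. *)
Definition nevanlinna_characteristic F (r : R) : \bar R :=
  (\int[mu]_(t in `]0%R, r])
    (pi^-1%:E *
     (\int[mu \x mu]_(p in [set p : R * R | (normc (p.1 +i* p.2) < t)%R])
        (spherical_derivative F (p.1 +i* p.2) ^+ 2)%:E) *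
     t^-1%:E))%E.

End Statement.

(* Main.v *)
Require Import Defs.
From mathcomp Require Import all_boot all_order all_algebra.
From mathcomp Require Import complex ring lra.
From mathcomp Require Import all_classical all_reals all_analysis.
From mathcomp Require Import measurable_realfun.

(** Why the theorem holds.

    Write [s_F] for the spherical derivative of [F], set to 0 at the poles
    ([affine_sder]).  Since [s_F <= F#], it is enough to bound areas computed
    with [s_F] from below.  Fix a scale [K], let [Q] be the square of side [2K]
    centred at the origin and [V(F)] the integral of [s_F ^ 2] over [Q].
    Translating [F] by the lattice [2K Z + 2K i Z] replaces [Q] by pairwise
    disjoint squares, so the area over a large disc is at least the sum of [V]
    over the translates of [F] by an [n] by [n] block of the lattice
    ([sum_area_le]).  A quadratic lower bound for the area, hence for the
    characteristic ([characteristic_liminf_gt0]), follows as soon as the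
    averages of [V] over these blocks stay away from 0.

    This much of the ergodic theorem is elementary.  For a measure-preserving
    [S] and [g >= 0] let [g'] be the infimum over [n] of the
    averages of [g] along the first [n] points of an orbit.  Garsia's proof of
    the maximal ergodic inequality gives [g' > 0] almost everywhere on
    [{g > 0}] ([lower_mean_eq0_negligible]).  Applying this to
    [g = min(V, 1)] and horizontal steps, and then to [g'] and vertical steps,
    yields a lower bound for all averages over square blocks; it is positive
    almost surely on [{V > 0}] ([ae_quadratic_growth]).

    So the conclusion can fail only for [F] such that [V(F) = 0] at every
    scale, that is, [s_F = 0] almost everywhere in the plane.  Such an [F] is
    constant ([ae_affine_sder0_cst]), and constants have probability 0.  This
    rigidity comes from differentiability at every single point.  On almost
    every horizontal line [s_F] vanishes almost everywhere; a curve whose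
    metric derivative is finite everywhere and zero almost everywhere is
    constant ([ae_zero_increment_cst], [sphere_curve_cst]), so [F] is constant
    on almost all horizontal lines, hence on all of them by continuity.  Then
    the complex derivative is zero wherever [F] is finite, and [F] is constant
    on vertical lines as well.

    The random variable [V] is measurable because, where [F] is finite,
    [s_F(z)] is the limit of expressions in the distances between values of
    [F], and these are continuous in [F] and in each coordinate of [z]
    ([measurable_caratheodory], [measurable_affine_sder]). *)

Set Implicit Arguments.
Unset Strict Implicit.
Unset Printing Implicit Defensive.
Import Order.TTheory GRing.Theory Num.Theory.
Import numFieldNormedType.Exports.
Import ComplexField.Normc.
Local Open Scope classical_set_scope.
Local Open Scope ring_scope.
Local Open Scope complex_scope.
Local Arguments normc : simpl never.

(** * The maximal ergodic inequality *)
Section MaximalErgodic.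
Context d (X : measurableType d) (R : realType) (P : probability X R).
Variables (S : X -> X) (g : X -> R).
Hypothesis mS : measurable_fun setT S.
Hypothesis S_inv : forall A, measurable A -> P (S @^-1` A) = P A.
Hypothesis mg : measurable_fun setT g.
Hypothesis g0 : forall x, 0 <= g x.

Definition birkhoff_sum n x := \sum_(i < n) g (iter i S x).

(** [excess c n x] is the maximum over [k <= n] of [k * c - birkhoff_sum k x].
    The recursion along the orbit, instead of a maximum of sums, is exactly the
    form in which Garsia's argument uses this quantity. *)
Fixpoint excess (c : R) n x : R :=
  if n is m.+1 then Num.max 0 (c - g x + excess c m (S x)) else 0.

Lemma excess_ge0 c n x : 0 <= excess c n x.
Proof. by case: n => //= n; rewrite le_max lexx. Qed.

Lemma excess_nd c n x : excess c n x <= excess c n.+1 x.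
Proof.
elim: n x => [|n IH] x; first exact: excess_ge0.
by rewrite [excess c n.+1 x]/= [excess c n.+2 x]/= ge_max !le_max lexx lerD2l IH orbT.
Qed.

Lemma excess_le c n x : 0 <= c -> excess c n x <= n%:R * c.
Proof.
move=> c0; elim: n x => [|n IH] x; first by rewrite mul0r.
rewrite /= ge_max mulr_ge0//= -natr1 mulrDl mul1r addrC lerD//.
by rewrite gerBl.
Qed.

Lemma measurable_excess c n : measurable_fun setT (excess c n).
Proof.
elim: n => [|n IH]; first exact: measurable_cst.
apply: measurable_maxr; first exact: measurable_cst.
apply: measurable_funD; last exact: measurableT_comp.
by apply: measurable_funB => //; exact: measurable_cst.
Qed.

Lemma birkhoff_sum_excess c n x : n%:R * c - birkhoff_sum n x <= excess c n x.
Proof.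
elim: n x => [|n IH] x; first by rewrite mul0r /birkhoff_sum big_ord0 subr0.
rewrite /= le_max; apply/orP; right.
rewrite /birkhoff_sum big_ord_recl/= -natr1 mulrDl mul1r.
have -> : \sum_(i < n) g (iter (bump 0 i) S x) = birkhoff_sum n (S x).
  by apply: eq_bigr => i _; rewrite -iterSr.
by have := IH (S x); lra.
Qed.

Lemma integral_invariant (f : X -> \bar R) : measurable_fun setT f ->
  (forall x, (0 <= f x)%E) ->
  (\int[P]_x f (S x) = \int[P]_x f x)%E.
Proof.
move=> mf f0.
rewrite -[LHS]/(\int[P]_(x in S @^-1` setT) (f \o S) x)%E.
rewrite -(@ge0_integral_pushforward _ _ _ _ _ _ mS P setT f)//.
apply: eq_measure_integral => A mA _; exact: S_inv.
Qed.

Lemma integral_const (r : R) : (\int[P]_x r%:E = r%:E)%E.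
Proof.
rewrite (@integral_cst _ _ _ P _ measurableT r%:E) -[RHS]mule1.
by congr (_ * _)%E; exact: probability_setT.
Qed.

(** Garsia's maximal inequality in weak form.  With [M_n = excess c n], the
    recursion gives [M_(n+1) + delta 1_A <= c + M_n o S] pointwise, where [A] is
    the set below.  Invariance of the measure turns the integral of [M_n o S]
    into that of [M_n], which is finite and at most that of [M_(n+1)], and
    cancels. *)
Lemma excess_level (c delta : R) n : 0 <= c -> 0 < delta ->
  (delta%:E * P [set x | (0 < excess c n x)%R /\ (delta <= g x)%R]
   <= c%:E)%E.
Proof.
move=> c0 delta0; case: n => [|n].
  rewrite (_ : [set x | _] = set0) ?measure0 ?mule0//.
  by apply/seteqP; split => x //= -[]; rewrite ltxx.
set A := [set x | _].
have mA : measurable A.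
  have -> : A = [set x | 0 < excess c n.+1 x] `&` [set x | delta <= g x] by [].
  apply: measurableI; rewrite -[X in measurable X]setTI.
    have -> : [set x | 0 < excess c n.+1 x] = excess c n.+1 @^-1` `]0, +oo[.
      by apply/seteqP; split => x /=; rewrite in_itv/= andbT.
    exact: measurable_excess.
  have -> : [set x | delta <= g x] = g @^-1` `[delta, +oo[.
    by apply/seteqP; split => x /=; rewrite in_itv/= andbT.
  exact: mg.
have mE k : measurable_fun setT (fun x => (excess c k x)%:E).
  by apply/measurable_EFinP; exact: measurable_excess.
pose I k : \bar R := (\int[P]_x (excess c k x)%:E)%E.
have Ifin k : I k \is a fin_num.
  rewrite ge0_fin_numE; last first.
    by apply: integral_ge0 => x _; rewrite lee_fin excess_ge0.
  apply: (@le_lt_trans _ _ (\int[P]_x (k%:R * c)%:E)%E).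
    apply: ge0_le_integral => //.
    - by move=> x _; rewrite lee_fin excess_ge0.
    - by move=> x _; rewrite lee_fin excess_le.
  by rewrite integral_const ltry.
have key : (I n.+1 + delta%:E * P A <= c%:E + I n)%E.
  have -> : (delta%:E * P A = \int[P]_x (delta * \1_A x)%:E)%E.
    under eq_integral do rewrite EFinM.
    rewrite ge0_integralZl//; last by rewrite lee_fin ltW.
      by rewrite integral_indic// setIT.
    by apply/measurable_EFinP; exact: measurable_indic.
  have -> : (I n = \int[P]_x (excess c n (S x))%:E)%E.
    rewrite (integral_invariant (f := fun x => (excess c n x)%:E))// => x.
    by rewrite lee_fin excess_ge0.
  rewrite -[X in (_ <= X + _)%E]integral_const.
  have mI : measurable_fun setT (fun x => (delta * \1_A x)%:E).
    by apply/measurable_EFinP; apply: measurable_funM => //;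
      exact: measurable_indic.
  have mES : measurable_fun setT (fun x => (excess c n (S x))%:E).
    by apply: (measurableT_comp (mE n)).
  rewrite -ge0_integralD//; last 2 first.
  - by move=> x _; rewrite lee_fin excess_ge0.
  - by move=> x _; rewrite lee_fin mulr_ge0// ltW.
  rewrite -ge0_integralD//; last by move=> x _; rewrite lee_fin excess_ge0.
  apply: ge0_le_integral => //.
  - by move=> x _; rewrite lee_fin addr_ge0 ?excess_ge0 ?mulr_ge0// ltW.
  - exact: emeasurable_funD.
  - exact: emeasurable_funD.
  move=> x _; rewrite lee_fin.
  have [xA|xA] := boolP (x \in A).
    have := xA; rewrite inE => -[].
    rewrite indicE xA mulr1/= => + gx; rewrite lt_max ltxx/= => h.
    rewrite max_r ?(ltW h)//; lra.
  rewrite indicE (negbTE xA) mulr0 addr0 /= ge_max.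
  have := excess_ge0 c n (S x); have := g0 x => ? ?.
  by apply/andP; split; lra.
have IH : (I n <= I n.+1)%E.
  apply: ge0_le_integral => //.
  - by move=> x _; rewrite lee_fin excess_ge0.
  - by move=> x _; rewrite lee_fin excess_nd.
have : (I n.+1 + delta%:E * P A <= I n.+1 + c%:E)%E.
  by apply: (le_trans key); rewrite addeC; exact: leeD2r.
by rewrite leeD2lE.
Qed.

Definition lower_mean x := inf (range (fun k => birkhoff_sum k.+1 x / k.+1%:R)).

Lemma has_lbound_means x : has_lbound (range (fun k => birkhoff_sum k.+1 x / k.+1%:R)).
Proof. by exists 0 => _ [k _ <-]; rewrite divr_ge0// sumr_ge0. Qed.

Lemma lower_mean_ge0 x : 0 <= lower_mean x.
Proof.
apply: lb_le_inf; first by exists (birkhoff_sum 1 x / 1%:R); exists 0%N.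
by move=> _ [k _ <-]; rewrite divr_ge0// sumr_ge0.
Qed.

Lemma measurable_lower_mean : measurable_fun setT lower_mean.
Proof.
pose h k x := birkhoff_sum k.+1 x / k.+1%:R.
have -> : lower_mean = fun x => infs (h^~ x) 0%N.
  apply/funext => x; rewrite /lower_mean /infs/=; congr inf.
  by apply/seteqP; split => _ [k _ <-]; exists k.
apply: measurable_fun_infs; first by move=> x _; exact: has_lbound_means.
move=> k; apply: measurable_funM; last exact: measurable_cst.
apply: measurable_sum => i; apply: measurableT_comp => //.
elim: (nat_of_ord i) => [|j IH]; first exact: measurable_id.
exact: measurableT_comp.
Qed.

Lemma lower_mean_le n x : n%:R * lower_mean x <= birkhoff_sum n x.
Proof.
case: n => [|n]; first by rewrite mul0r /birkhoff_sum big_ord0.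
rewrite mulrC -ler_pdivlMr//.
by apply: (ge_inf (has_lbound_means x)); exists n.
Qed.

(** Where [lower_mean] vanishes, some average drops below any given
    [c = e * delta], so some [excess c n] is positive there.  By
    [excess_level] the part of this set on which [g >= delta] has measure at
    most [c / delta = e], for every [e > 0]. *)
Lemma lower_mean_eq0_negligible : P.-negligible [set x | lower_mean x = 0 /\ 0 < g x].
Proof.
have mZ : measurable [set x | lower_mean x = 0].
  rewrite -[X in measurable X]setTI.
  have -> : [set x | lower_mean x = 0] = lower_mean @^-1` [set 0] by [].
  exact: measurable_lower_mean.
have mG (r : R) : measurable [set x | r <= g x].
  rewrite -[X in measurable X]setTI.
  have -> : [set x | r <= g x] = g @^-1` `[r, +oo[.
    by apply/seteqP; split => x /=; rewrite in_itv/= andbT.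
  exact: mg.
pose A k := [set x | lower_mean x = 0] `&` [set x | k.+1%:R^-1 <= g x].
have -> : [set x | lower_mean x = 0 /\ 0 < g x] = \bigcup_k A k.
  apply/seteqP; split => x.
    move=> [x0 gx]; exists (Num.truncn (g x)^-1) => //; split => //=.
    by rewrite invf_ple ?posrE// ltW// truncnS_gt.
  by move=> [k _ [x0 gx]]; split => //; exact: lt_le_trans gx.
have mA k : measurable (A k) by exact: measurableI.
apply: negligible_bigcup => k; apply/negligibleP => //.
apply/eqP; rewrite -measure_le0; apply/lee_addgt0Pr => e e0; rewrite add0e.
set delta : R := k.+1%:R^-1.
have delta0 : 0 < delta by rewrite invr_gt0.
pose F n := [set x | 0 < excess (e * delta) n x /\ delta <= g x].
have mF n : measurable (F n).
  have -> : F n = [set x | 0 < excess (e * delta) n x] `&` [set x | delta <= g x] by [].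
  apply: measurableI => //; rewrite -[X in measurable X]setTI.
  have -> : [set x | 0 < excess (e * delta) n x] = excess (e * delta) n @^-1` `]0, +oo[.
    by apply/seteqP; split => x /=; rewrite in_itv/= andbT.
  exact: measurable_excess.
have AF : A k `<=` \bigcup_n F n.
  move=> x [x0 gx].
  have ed : 0 < e * delta by rewrite mulr_gt0.
  have : inf (range (fun k => birkhoff_sum k.+1 x / k.+1%:R)) < e * delta.
    by rewrite [X in X < _]x0.
  move=> /inf_lt [|_ [n _ <-]].
    by exists (birkhoff_sum 1 x / 1%:R); exists 0%N.
  rewrite ltr_pdivrMr// mulrC => h; exists n.+1 => //; split => //.
  by apply: lt_le_trans (birkhoff_sum_excess _ _ _); rewrite subr_gt0.
have /le_trans -> // : (P (A k) <= P (\bigcup_n F n))%E.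
  by apply: le_measure; rewrite ?inE//; exact: bigcup_measurable.
have cvF : P (F n) @[n --> \oo] --> P (\bigcup_n F n).
  apply: nondecreasing_cvg_mu => //; first exact: bigcup_measurable.
  apply/nondecreasing_seqP => n; apply/subsetPset => x [h ?]; split => //.
  exact: lt_le_trans h (excess_nd _ _ _).
rewrite -(cvg_lim _ cvF)//; apply: lime_le; first by apply/cvg_ex; eexists; exact: cvF.
near=> n.
have := excess_level n (ltW (mulr_gt0 e0 delta0)) delta0.
by rewrite -/(F n) EFinM muleC lee_pmul2r// ?lte_fin.
Unshelve. all: by end_near. Qed.

End MaximalErgodic.

(** * Real functions whose derivative vanishes almost everywhere *)
Section ZeroDerivative.
Variable R : realType.
Local Notation mu := (@lebesgue_measure R).

(** Supremum argument: the last point [s] of [[a, b]] with [w s <= w a] can only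
    be [b].  Lipschitz control from the left makes the supremum a point of the
    set; the second hypothesis moves on from there. *)
Lemma creeping_le (w : R -> R) (a b : R) : a <= b ->
  (forall x, a <= x <= b -> exists C, \forall y \near x,
     a <= y <= x -> w x - w y <= C * (x - y)) ->
  (forall x, a <= x < b -> exists2 y, x < y <= b & w y <= w x) ->
  w b <= w a.
Proof.
move=> ab left right.
pose A := [set x | a <= x <= b /\ w x <= w a].
have A0 : A a by split; rewrite ?lexx.
have ubA : ubound A b by move=> x [/andP[]].
have hA : has_sup A by split; [exists a|exists b].
set s := sup A.
have as_ : a <= s by apply: ub_le_sup => //; exists b.
have sb : s <= b by apply: ge_sup => //; exists a.
have As : w s <= w a.
  have [C] := left s ltac:(by rewrite as_ sb).
  move=> /nbhs_ballP[r /= r0 rP].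
  apply/ler_addgt0Pr => e e0.
  pose D := Num.max C 1.
  have D0 : 0 < D by rewrite lt_max ltr01 orbT.
  pose h := Num.min r (e / D).
  have h0 : 0 < h by rewrite lt_min r0 divr_gt0.
  have [x [/andP[ax xb] wx] xs] := sup_adherent h0 hA.
  have xs' : x <= s by apply: ub_le_sup => //; [exists b|split => //; rewrite ax].
  have sxh : s - x < h by rewrite -/s in xs; lra.
  have := rP x; rewrite /ball/= ger0_norm ?subr_ge0//.
  have sxr : s - x < r by rewrite (lt_le_trans sxh)// ge_min lexx.
  have sxe : s - x < e / D by rewrite (lt_le_trans sxh)// ge_min lexx orbT.
  move=> /(_ sxr); rewrite ax xs' => /(_ isT).
  move=> H; have : w s - w x <= e.
    apply: (le_trans H); apply: (@le_trans _ _ (D * (s - x))).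
      by rewrite ler_wpM2r ?subr_ge0// le_max lexx.
    by rewrite mulrC -ler_pdivlMr// ltW.
  by lra.
move: sb; rewrite le_eqVlt => /predU1P[<-//|sb].
have [y /andP[sy yb] wy] := right s ltac:(by rewrite as_ sb).
suff : y <= s by rewrite leNgt sy.
apply: ub_le_sup; first by exists b.
split; first by rewrite yb andbT ltW// (le_lt_trans as_).
exact: le_trans As.
Qed.

(** A finite measure whose density is infinite on a null set: the sum of the
    restrictions of Lebesgue measure to open sets [U_n] containing [N], of
    measure at most [2 ^ -(n + 1)].  Near a point of [N], any number of the
    [U_n] contains the interval between the point and its neighbour. *)
Lemma null_set_weight (N : set R) : mu.-negligible N ->
  exists nu : {measure set (measurableTypeR R) -> \bar R},
    (nu setT <= 1)%E /\
    forall x, N x -> forall C : R, \forall y \near x, x <= y ->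
      ((C * (y - x))%:E <= nu `]x, y]%classic)%E.
Proof.
move=> [N' [mN' muN' NN']].
have /choice[U UP] : forall n, exists U : set R, [/\ open U, N' `<=` U &
    (mu U <= (1 / (2 ^ n.+1)%:R)%:E)%E].
  move=> n.
  have e0 : 0 < (1 / (2 ^ n.+1)%:R) :> R by rewrite divr_gt0// ltr0n expn_gt0.
  have [|U [oU NU muU]] := lebesgue_regularity_outer mN' _ e0.
    by rewrite [X in (X < _)%E]muN' ltry.
  exists U; split => //.
  rewrite -(setDUK NU) (le_trans (measureU2 _ _ _))//.
    by apply: measurableD => //; exact: open_measurable.
  by rewrite [X in (X + _)%E]muN' add0e ltW.
have mU n : measurable (U n : set (measurableTypeR R)).
  by have [? _ _] := UP n; exact: open_measurable.
pose nu := mseries (fun n => mrestr mu (mU n)) 0.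
exists nu; split.
  apply: (le_trans _ (@epsilon_trick0 R 1 xpredT ler01)).
  apply: lee_nneseries => n _ //=.
  by rewrite /mrestr setTI; have [_ _] := UP n.
move=> x Nx C.
have [n Cn] : exists n : nat, C <= n%:R.
  by exists (Num.truncn C).+1; rewrite ltW// truncnS_gt.
have : \forall y \near x, forall i, (i < n)%N -> `[x, y] `<=` U i.
  elim: n {Cn} => [|n IH]; first by near=> y => i.
  have [oU NU _] := UP n.
  have /nbhs_ballP[r /= r0 rP] := open_nbhs_nbhs (conj oU (NU _ (NN' _ Nx))).
  have : \forall y \near x, ball x r y by exact: nbhsx_ballx.
  apply: filter_app; move: IH; apply: filter_app; near=> y => IH yr i.
  rewrite ltnS leq_eqVlt => /predU1P[->|/IH//].
  move=> z /=; rewrite in_itv/= => /andP[xz zy]; apply: rP.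
  move: yr; rewrite /ball/= ler0_norm ?ler0_norm ?subr_le0 ?(le_trans xz)//; lra.
apply: filterS => y yU xy.
apply: (@le_trans _ _ (\sum_(0 <= i < n) (y - x)%:E)%E).
  rewrite sumEFin lee_fin sumr_const_nat subn0 -mulr_natl.
  by rewrite ler_wpM2r ?subr_ge0.
apply: (le_trans _ (@nneseries_lim_ge _ _ xpredT 0 n _)) => //.
rewrite big_nat_cond [leRHS]big_nat_cond; apply: lee_sum => i /=.
rewrite andbT => /yU yUi; rewrite /mrestr setIidl.
  rewrite lebesgue_measure_itv/= lte_fin.
  by case: ltP xy => // yx xy; rewrite lee_fin subr_le0.
by apply: subset_trans yUi; apply: subset_itvr; rewrite bnd_simp.
Unshelve. all: by end_near. Qed.


(** The function [u y - e (y - a) - e nu]a, y]], with [nu] the weight of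
    [null_set_weight], moves down to the right of every point: outside [N]
    because [u] has zero derivative, on [N] because the finite slope of [u] is
    beaten by the infinite slope of [nu].  Hence it is bounded by its value at
    [a], and [nu] has total mass at most 1. *)
Lemma ae_zero_increment_le (u : R -> R) (N : set R) (a b e : R) :
  mu.-negligible N ->
  (forall x : R, exists C : R, \forall y \near x, `|u y - u x| <= C * `|y - x|) ->
  (forall x : R, ~ N x -> forall e : R, 0 < e ->
     \forall y \near x, `|u y - u x| <= e * `|y - x|) ->
  a <= b -> 0 < e -> u b - u a <= e * (b - a + 1).
Proof.
move=> N0 lip zero ab e0.
have [nu [nu1 nuN]] := null_set_weight N0.
have nufin (A : set (measurableTypeR R)) : measurable A -> nu A \is a fin_num.
  move=> mA; rewrite ge0_fin_numE//; apply: le_lt_trans (ltry 1).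
  by apply: le_trans nu1; apply: le_measure; rewrite ?inE.
pose psi y : R := fine (nu `]a, y]%classic).
have psi_diff x y : a <= x -> x <= y ->
    psi y - psi x = fine (nu `]x, y]%classic).
  move=> ax xy; rewrite /psi.
  have -> : `]a, y]%classic = `]a, x]%classic `|` `]x, y]%classic.
    by rewrite -itv_bndbnd_setU// bnd_simp.
  rewrite measureU//; last first.
    apply/seteqP; split => z //=; rewrite !in_itv/= => -[/andP[_ zx] /andP[xz _]].
    by move: (lt_le_trans xz zx); rewrite ltxx.
  by rewrite fineD ?nufin// addrC addKr.
have psi_nd x y : a <= x -> x <= y -> psi x <= psi y.
  by move=> ax xy; rewrite -subr_ge0 psi_diff// fine_ge0.
have psi_le1 y : psi y <= 1.
  rewrite -lee_fin fineK ?nufin//; apply: le_trans nu1.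
  by apply: le_measure; rewrite ?inE.
have psi_a : psi a = 0 by rewrite /psi set_itv_ge ?bnd_simp ?ltxx// measure0.
pose w y := u y - e * (y - a) - e * psi y.
suff : w b <= w a.
  rewrite /w psi_a subrr !mulr0 !subr0 => wba.
  have : e * psi b <= e * 1 by rewrite ler_pM2l.
  by rewrite mulr1 mulrDr mulr1; lra.
apply: creeping_le => // x.
- move=> /andP[ax xb]; have [C CP] := lip x; exists C.
  near=> y => /andP[ay yx].
  have : u x - u y <= C * (x - y).
    apply: (le_trans (ler_norm _)); rewrite distrC.
    apply: (le_trans (near CP y _)) => //.
    by rewrite distrC ger0_norm// subr_ge0.
  have : e * psi y <= e * psi x by rewrite ler_pM2l// psi_nd.
  have : e * (y - a) <= e * (x - a) by rewrite ler_pM2l// lerD2r.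
  rewrite /w; lra.
- move=> /andP[ax xb].
  have : \forall y \near x, x < y -> w y <= w x.
    have [Nx|Nx] := pselect (N x).
      have [C CP] := lip x.
      have := nuN x Nx (C / e); apply: filter_app.
      near=> y => nuC xy.
      have := nuC (ltW xy); rewrite -[X in (_ <= X)%E]fineK ?nufin// lee_fin.
      rewrite -psi_diff ?(ltW xy)// mulrAC ler_pdivrMr// => H.
      have : u y - u x <= C * (y - x).
        apply: (le_trans (ler_norm _)).
        apply: (le_trans (near CP y _)) => //.
        by rewrite ger0_norm// subr_ge0 ltW.
      have : e * (x - a) <= e * (y - a) by rewrite ler_pM2l// lerD2r ltW.
      rewrite /w; lra.
    near=> y => xy.
    have : u y - u x <= e * (y - x).
      apply: (le_trans (ler_norm _)).
      apply: (le_trans (near (zero x Nx e e0) y _)) => //.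
      by rewrite ger0_norm// subr_ge0 ltW.
    have : e * psi x <= e * psi y by rewrite ler_pM2l// psi_nd// ltW.
    rewrite /w; lra.
  move=> /nbhs_ballP[r /= r0 rP].
  pose y := Num.min b (x + r / 2).
  have xy : x < y by rewrite lt_min xb ltrDl divr_gt0.
  exists y; first by rewrite xy ge_min lexx.
  apply: rP => //; rewrite /ball/= ltr0_norm ?subr_lt0//.
  have : y <= x + r / 2 by rewrite ge_min lexx orbT.
  by lra.
Unshelve. all: by end_near. Qed.

(** Finiteness of the slope at every single point, and not just almost
    everywhere, is what excludes functions of the Cantor type. *)
Lemma ae_zero_increment_cst (u : R -> R) (N : set R) :
  mu.-negligible N ->
  (forall x : R, exists C : R, \forall y \near x, `|u y - u x| <= C * `|y - x|) ->
  (forall x : R, ~ N x -> forall e : R, 0 < e ->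
     \forall y \near x, `|u y - u x| <= e * `|y - x|) ->
  forall a b, u a = u b.
Proof.
move=> N0 lip zero.
suff H a b : a <= b -> u a = u b.
  by move=> a b; have [/H|/ltW/H] := leP a b.
move=> ab; have ba0 : 0 < b - a + 1 by rewrite ltr_wpDl// subr_ge0.
apply/eqP; rewrite eq_le; apply/andP; split; apply/ler_addgt0Pr => e e0.
  suff : (\- u) b - (\- u) a <= e by rewrite /=; lra.
  rewrite -[leRHS](divfK (lt0r_neq0 ba0)).
  apply: (ae_zero_increment_le N0) => //.
  - move=> x; have [C CP] := lip x; exists C; near=> y.
    by rewrite /= -opprD normrN; near: y.
  - move=> x Nx e' e'0; near=> y.
    by rewrite /= -opprD normrN; near: y; exact: zero.
  - by rewrite divr_gt0.
rewrite -lerBlDl -[leRHS](divfK (lt0r_neq0 ba0)).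
by apply: (ae_zero_increment_le N0) => //; rewrite divr_gt0.
Unshelve. all: by end_near. Qed.

End ZeroDerivative.

(** * First-order behaviour of meromorphic functions in the spherical metric *)
Section Plane.
Variable R : realType.
Implicit Types (z w h : plane R) (e r : R).

Lemma normE z : `|z| = (normc z)%:C.
Proof. by case: z. Qed.

Lemma normc_ge0 (z : R[i]) : 0 <= normc z.
Proof. by case: z => a b; exact: sqrtr_ge0. Qed.

Lemma normcD (z w : R[i]) : normc (z + w) <= normc z + normc w.
Proof. exact: (@ler_normD R (Rcomplex R)). Qed.

Lemma normcN (z : R[i]) : normc (- z) = normc z.
Proof. exact: (@normrN R (Rcomplex R)). Qed.

Lemma normc_dist (z w : R[i]) : `|normc z - normc w| <= normc (z - w).
Proof.
have := normcD (z - w) w; have := normcD (w - z) z.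
by rewrite !subrK -(normcN (w - z)) opprB ler_norml; lra.
Qed.

Lemma normc_real (x : R) : normc x%:C = `|x|.
Proof. by rewrite /normc /= expr0n addr0 sqrtr_sqr. Qed.

Lemma normc_imag (x : R) : normc (0 +i* x) = `|x|.
Proof. by rewrite /normc /= expr0n add0r sqrtr_sqr. Qed.

Lemma nbhs_planeP z (P : set (plane R)) :
  nbhs z P <-> exists2 r : R, 0 < r & forall w, normc (w - z) < r -> P w.
Proof.
split.
  move=> /nbhs_ballP[[r s]] /=; rewrite ltcE/= => /andP[/eqP s0 r0] rP.
  exists r => // w wr; apply: rP; rewrite /ball/= distrC normE.
  by rewrite ltcE/= s0 eqxx.
move=> [r r0 rP]; apply/nbhs_ballP; exists r%:C; first by rewrite /= ltcR.
by move=> w; rewrite /ball/= distrC normE ltcR => /rP.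
Qed.

Lemma derivable_expansion (f : plane R -> plane R) z : derivable f z 1 ->
  forall e, 0 < e -> \forall w \near z,
    normc (f w - f z - derive1 f z * (w - z)) <= e * normc (w - z).
Proof.
move=> /derivable_nbhs/eqaddoP H e e0.
have e0' : 0 < e%:C by rewrite ltcR.
have /nbhs_planeP[r r0 rP] := H _ e0'.
apply/nbhs_planeP; exists r => // w wr.
have := rP (w - z); rewrite subr0 => /(_ wr).
rewrite /= !normE -[_ * _]rmorphM lecR.
set X := (X in normc X <= _ -> _).
have -> : X = f w - (f z + (w - z) * 'D_1 f z).
  rewrite /X; transitivity (f ((w - z) * 1 + z) - (f z + (w - z) * 'D_1 f z)).
    by [].
  by rewrite mulr1 subrK.
by rewrite derive1E opprD addrA [_ * (w - z)]mulrC.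
Qed.
End Plane.

Section Sphere.
Variable R : realType.
Implicit Types (p q r : riemann_sphere R) (a b : R[i]) (e : R).
Local Notation rho := (@spherical_dist R).
Local Notation N a := (Num.sqrt (1 + normc a ^+ 2)).

Lemma rho_ge0 p q : 0 <= rho p q.
Proof. exact: (@mdist_ge0 R (riemann_sphere R)). Qed.

Lemma rhoxx p : rho p p = 0.
Proof. exact: (@mdistxx R (riemann_sphere R)). Qed.

Lemma rho_sym p q : rho p q = rho q p.
Proof. exact: (@metric_sym R (riemann_sphere R)). Qed.

Lemma rho_triangle q p r : rho p r <= rho p q + rho q r.
Proof. exact: (@metric_triangle R (riemann_sphere R)). Qed.

Lemma rho_gt0 p q : (0 < rho p q) = (p != q).
Proof. exact: (@mdist_gt0 R (riemann_sphere R)). Qed.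

Lemma rho_lip p q r : `|rho p r - rho q r| <= rho p q.
Proof.
have := rho_triangle q p r; have := rho_triangle p q r.
by rewrite (rho_sym q p) ler_norml; lra.
Qed.

Lemma N_ge1 a : 1 <= N a.
Proof. by rewrite -[leLHS]sqrtr1 ler_wsqrtr// lerDl exprn_ge0// normc_ge0. Qed.

Lemma N_gt0 a : 0 < N a.
Proof. exact: lt_le_trans (N_ge1 a). Qed.

Lemma chordal_ge0 p q : 0 <= chordal_dist p q.
Proof.
case: p q => [a|] [b|] //=; rewrite ?invr_ge0 ?sqrtr_ge0//.
by rewrite divr_ge0 ?normc_ge0// mulr_ge0 ?sqrtr_ge0.
Qed.

Lemma chordal_le1 p q : chordal_dist p q <= 1.
Proof.
case: p q => [a|] [b|] //=; rewrite ?invf_le1 ?N_gt0 ?N_ge1//.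
rewrite ler_pdivrMr ?mulr_gt0 ?N_gt0// mul1r.
rewrite -(@ler_pXn2r _ 2) ?nnegrE ?normc_ge0 ?mulr_ge0 ?sqrtr_ge0//.
rewrite exprMn !sqr_sqrtr ?addr_ge0 ?exprn_ge0 ?normc_ge0//.
have normcsq (z : R[i]) : normc z ^+ 2 = complex.Re z ^+ 2 + complex.Im z ^+ 2.
  by case: z => x y; rewrite /normc /= sqr_sqrtr// addr_ge0// sqr_ge0.
rewrite !normcsq; case: a b => [x y] [u v] /=.
rewrite -subr_ge0; set E := (X in 0 <= X).
have -> : E = (1 + x * u + y * v) ^+ 2 + (x * v - y * u) ^+ 2 by rewrite /E; ring.
by rewrite addr_ge0// sqr_ge0.
Qed.

Lemma sin_rho p q : sin (rho p q) = chordal_dist p q.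
Proof.
rewrite /spherical_dist asinK// in_itv/= chordal_le1 andbT.
by rewrite (le_trans _ (chordal_ge0 p q))// lerN10.
Qed.

(** Distances on the sphere are small angles whose sine is the explicit chordal
    expression, so bounds for chordal distances transfer to [spherical_dist]. *)
Lemma sin_ge_half : exists2 d : R, 0 < d & forall x, 0 <= x < d -> x <= 2 * sin x.
Proof.
have : \forall y \near (0 : R), 2^-1 < cos y.
  have : cos y @[y --> (0 : R)] --> cos (0 : R) by exact: continuous_cos.
  by move=> /(cvgr_gt (cos 0)); apply; rewrite cos0 invf_lt1// ltr1n.
move=> /nbhs_ballP[d /= d0 dP]; exists d => // x /andP[].
rewrite le_eqVlt => /predU1P[<- _|x0 xd]; first by rewrite sin0 mulr0.
have [|c] := @MVT R sin cos 0 x x0 (fun x _ => is_derive_sin x).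
  by apply: continuous_subspaceT; exact: continuous_sin.
rewrite in_itv/= => /andP[c0 cx]; rewrite sin0 !subr0 => ->.
have : 2^-1 < cos c.
  by apply: dP; rewrite /ball/= sub0r normrN gtr0_norm// (lt_trans cx).
move=> hc; rewrite mulrA ler_peMl ?(ltW x0)//; lra.
Qed.

Lemma cvg_sphereP (T : Type) (G : set_system T) (FG : Filter G)
    (F : T -> riemann_sphere R) p :
  F @ G --> p <-> forall e, 0 < e -> \forall t \near G, rho p (F t) < e.
Proof. exact: (@metricType_numDomainType.cvgrPdist_lt R (riemann_sphere R)). Qed.

End Sphere.

Section Derivative.
Variable R : realType.
Variables (F : plane R -> riemann_sphere R) (z : plane R).
Hypothesis cF : F w @[w --> z] --> F z.
Hypothesis Fz : F z <> None.
Let f := @finite_part R \o F.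
Hypothesis df : derivable f z 1.
Local Notation rho := (@spherical_dist R).
Local Notation N a := (Num.sqrt (1 + normc a ^+ 2)).
Local Notation D := (normc (derive1 f z)).

Lemma near_finite : \forall w \near z, F w = Some (f w).
Proof.
have : \forall w \near z, rho (F z) (F w) < rho (F z) None.
  by move/cvg_sphereP : cF; apply; rewrite rho_gt0; apply/eqP.
apply: filterS => w; rewrite /f /=.
by case: (F w) => //=; rewrite ltxx.
Qed.

Lemma normc_increment (e : R) : 0 < e ->
  \forall w \near z, normc (f w - f z) <= (D + e) * normc (w - z).
Proof.
move=> /(derivable_expansion df); apply: filterS => w H.
rewrite -[f w - f z](subrK (derive1 f z * (w - z))).
by rewrite (le_trans (normcD _ _))// normcM addrC mulrDl lerD2l.
Qed.

Lemma rho_increment (e : R) : 0 < e ->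
  \forall w \near z, rho (F w) (F z) <= 2 * (D + e) * normc (w - z).
Proof.
move=> e0; have [d d0 dP] := sin_ge_half R.
have near1 : \forall w \near z, rho (F z) (F w) < d.
  by move/cvg_sphereP : cF; apply.
near=> w.
apply: (@le_trans _ _ (2 * sin (rho (F w) (F z)))).
  by rewrite dP// rho_ge0/= rho_sym; near: w.
rewrite -mulrA ler_pM2l// sin_rho.
rewrite (near near_finite w)// (nbhs_singleton near_finite)//=.
rewrite ler_pdivrMr ?mulr_gt0 ?N_gt0//.
apply: (@le_trans _ _ ((D + e) * normc (w - z))).
  by near: w; exact: normc_increment.
rewrite ler_peMr ?mulr_ge0 ?addr_ge0 ?normc_ge0 ?(ltW e0)//.
by rewrite -[leLHS]mulr1 ler_pM// N_ge1.
Unshelve. all: by end_near. Qed.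

(** The spherical derivative is a limit of expressions that only involve
    distances between values of [F]; this is how it becomes a measurable
    function of [F]. *)
Lemma cvg_difference_quotient (w : nat -> plane R) :
  (forall n, w n != z) -> w n @[n --> \oo] --> z ->
  sin (rho (F (w n)) (F z)) / normc (w n - z) @[n --> \oo] -->
    D / (1 + normc (f z) ^+ 2).
Proof.
move=> wz cw.
have cvgD0 : normc (f (w n) - f z) / normc (w n - z) @[n --> \oo] --> D.
  apply/cvgrPdist_le => e e0.
  have := cw _ (derivable_expansion df e0); rewrite /nbhs/=.
  apply: filterS => n /= H.
  have wn0 : 0 < normc (w n - z).
    rewrite lt_neqAle normc_ge0 andbT eq_sym; apply/eqP => /eq0_normc/eqP.
    by rewrite subr_eq0 (negbTE (wz n)).
  have -> : D = normc (derive1 f z * (w n - z)) / normc (w n - z).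
    by rewrite normcM mulfK// gt_eqF.
  rewrite -mulrBl normrM normfV (gtr0_norm wn0) ler_pdivrMr//.
  apply: le_trans H; rewrite -[f (w n) - f z - _]opprB normcN.
  exact: normc_dist.
have cvgf : normc (f (w n)) @[n --> \oo] --> normc (f z).
  apply/cvgrPdist_lt => e e0.
  have : \forall w \near z, `|normc (f z) - normc (f w)| < e.
    have K0 : 0 < D + 1 by rewrite ltr_wpDl ?normc_ge0.
    have : \forall w \near z, normc (w - z) < e / (D + 1).
      by apply/nbhs_planeP; exists (e / (D + 1)) => //; rewrite divr_gt0.
    apply: filterS2 (normc_increment ltr01) => u Hu uz.
    apply: (@le_lt_trans _ _ (normc (f u - f z))).
      by rewrite distrC normc_dist.
    by apply: (le_lt_trans Hu); rewrite mulrC -ltr_pdivlMr.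
  by move=> /cw.
have cvgN : N (f (w n)) @[n --> \oo] --> N (f z).
  apply: (@continuous_cvg _ _ _ _ _ _ Num.sqrt); first exact: sqrt_continuous.
  by apply: cvgD; [exact: cvg_cst|exact: (@cvgM _ _ _ _ _ _ _ _ cvgf cvgf)].
have : normc (f (w n) - f z) / normc (w n - z) / (N (f (w n)) * N (f z))
    @[n --> \oo] --> D / (N (f z) * N (f z)).
  apply: cvgM => //; apply: cvgV; first by rewrite gt_eqF// mulr_gt0 ?N_gt0.
  by apply: cvgM => //; exact: cvg_cst.
rewrite -[N (f z) * N (f z)]expr2 sqr_sqrtr ?addr_ge0 ?exprn_ge0 ?normc_ge0//.
apply: cvg_trans; apply: near_eq_cvg.
have : \forall n \near \oo, F (w n) = Some (f (w n)) by exact: cw _ near_finite.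
apply: filterS => n Fn.
rewrite sin_rho Fn (nbhs_singleton near_finite)/= mulrAC.
by [].
Qed.

End Derivative.

(** * Rigidity: vanishing spherical derivative forces constancy *)
Section Rigidity.
Variable R : realType.
Local Notation rho := (@spherical_dist R).
Local Notation mu := (@lebesgue_measure R).

(** At times when the curve is at infinity the hypotheses bound no slope.
    Truncating the distance to a finite base point [gamma t0] at half its
    distance from infinity gives a real function that is locally constant near
    those times and nowhere steeper than the curve. *)
Lemma sphere_curve_cst (gamma : R -> riemann_sphere R) (N : set R) :
  mu.-negligible N ->
  (forall t : R, gamma s @[s --> t] --> gamma t) ->
  (forall t : R, gamma t <> None ->
    exists C : R, \forall s \near t, rho (gamma s) (gamma t) <= C * `|s - t|) ->
  (forall t : R, ~ N t -> gamma t <> None -> forall e : R, 0 < e ->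
    \forall s \near t, rho (gamma s) (gamma t) <= e * `|s - t|) ->
  forall s t, gamma s = gamma t.
Proof.
move=> N0 cont lip zero.
have [allN|/existsNP[t0 t0N]] := pselect (forall t, gamma t = None).
  by move=> s t; rewrite !allN.
pose c := rho None (gamma t0) / 2.
have c0 : 0 < c by rewrite divr_gt0// rho_gt0 eq_sym; apply/eqP.
pose u t := Num.min (rho (gamma t) (gamma t0)) c.
have u_lip s t : `|u s - u t| <= rho (gamma s) (gamma t).
  have := rho_lip (gamma s) (gamma t) (gamma t0).
  rewrite /u; set a := rho (gamma s) (gamma t0); set b := rho (gamma t) _.
  rewrite !ler_norml => /andP[? ?].
  by case: (lerP a c) => ?; case: (lerP b c) => ?; apply/andP; split; lra.
have u_infty t : gamma t = None -> \forall s \near t, u s = u t.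
  move=> tN; have : \forall s \near t, rho (gamma t) (gamma s) < c.
    by have /cvg_sphereP := cont t; apply.
  apply: filterS => s; rewrite tN => H.
  have := rho_triangle (gamma s) None (gamma t0).
  have cE : rho None (gamma t0) = c + c by rewrite /c; lra.
  by rewrite /u tN cE => K; rewrite !min_r//; lra.
have uc : forall a b, u a = u b.
  apply: (ae_zero_increment_cst N0).
    move=> t; have [tN|tN] := pselect (gamma t = None).
      exists 0; apply: filterS (u_infty _ tN) => s ->.
      by rewrite subrr normr0 mul0r.
    have [C CP] := lip t tN; exists C; apply: filterS CP => s.
    exact: le_trans (u_lip _ _).
  move=> t Nt e e0; have [tN|tN] := pselect (gamma t = None).
    apply: filterS (u_infty _ tN) => s ->.
    by rewrite subrr normr0 mulr_ge0// ltW.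
  by apply: filterS (zero t Nt tN e e0) => s; exact: le_trans (u_lip _ _).
suff H t : gamma t = gamma t0 by move=> s t; rewrite !H.
apply/eqP; apply: contraT; rewrite -rho_gt0 => h.
have := uc t t0; rewrite /u rhoxx [RHS]min_l ?(ltW c0)// => u0.
have : 0 < Num.min (rho (gamma t) (gamma t0)) c by rewrite lt_min h.
by rewrite u0 ltxx.
Qed.

Implicit Types F : merofun R.

Lemma meroP F : meromorphic F.
Proof. exact: (set_valP F). Qed.

Lemma mero_continuous F z : F w @[w --> z] --> F z.
Proof. by have [cF _] := meroP F; exact: cF. Qed.

Lemma mero_derivable F z : F z <> None -> derivable (@finite_part R \o F) z 1.
Proof. by have [_ /(_ z)[]] := meroP F. Qed.

(** Discarding the poles costs nothing, as only lower bounds for areas are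
    needed, and it avoids the limit in the definition at poles. *)
Definition affine_sder F (z : plane R) : R :=
  if F z == None then 0 else finite_spherical_derivative F z.

Lemma affine_sder_ge0 F z : 0 <= affine_sder F z.
Proof.
rewrite /affine_sder; case: ifP => // _; rewrite /finite_spherical_derivative.
by rewrite divr_ge0 ?normc_ge0// addr_ge0// exprn_ge0 ?normc_ge0.
Qed.

Lemma affine_sder_eq0 F z : F z <> None -> affine_sder F z = 0 ->
  normc (derive1 (@finite_part R \o F) z) = 0.
Proof.
move=> Fz; rewrite /affine_sder; case: eqP => // _ /eqP.
rewrite /finite_spherical_derivative mulf_eq0 invr_eq0 => /orP[/eqP//|].
by rewrite gt_eqF// ltr_wpDr ?exprn_ge0 ?normc_ge0.
Qed.

Lemma cvg_affine_sder F z (w : nat -> plane R) :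
  F z <> None -> (forall n, w n != z) -> w n @[n --> \oo] --> z ->
  sin (rho (F (w n)) (F z)) / normc (w n - z) @[n --> \oo] --> affine_sder F z.
Proof.
move=> Fz wz cw; rewrite /affine_sder; case: eqP => // _.
exact: (cvg_difference_quotient (@mero_continuous F z) Fz (mero_derivable Fz)).
Qed.

(** Lines are parametrised as [z + t v] with [v] of modulus 1, so horizontal
    and vertical lines are both instances. *)
Lemma near_line (z v : plane R) (t : R) (P : plane R -> Prop) : normc v = 1 ->
  (\forall w \near (z + t%:C * v : plane R), P w) ->
  \forall s \near t, P (z + s%:C * v).
Proof.
move=> v1 /nbhs_planeP[r r0 rP]; apply/nbhs_ballP; exists r => // s.
rewrite /ball/= distrC => st; apply: rP.
by rewrite opprD addrACA subrr add0r -mulrBl -rmorphB normcM v1 mulr1 normc_real.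
Qed.

Lemma line_cst F (z v : plane R) (N : set R) : normc v = 1 ->
  mu.-negligible N ->
  (forall t : R, ~ N t -> affine_sder F (z + t%:C * v) = 0) ->
  forall t : R, F (z + t%:C * v) = F z.
Proof.
move=> v1 N0 Nz t.
pose gamma t : riemann_sphere R := F (z + t%:C * v).
have incr (s r : R) : normc ((z + s%:C * v) - (z + r%:C * v)) = `|s - r|.
  by rewrite opprD addrACA subrr add0r -mulrBl -rmorphB normcM v1 mulr1 normc_real.
have -> : F z = gamma 0 by rewrite /gamma mul0r addr0.
apply: (@sphere_curve_cst gamma N N0) => r.
- move=> A /mero_continuous; exact: near_line.
- move=> rF; exists (2 * (normc (derive1 (@finite_part R \o F) (z + r%:C * v)) + 1)).
  have := rho_increment (@mero_continuous F _) rF (mero_derivable rF) ltr01.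
  by move=> /(near_line v1); apply: filterS => s; rewrite incr.
- move=> /Nz + rF e e0 => /(affine_sder_eq0 rF) D0.
  have e2 : 0 < e / 2 by rewrite divr_gt0.
  have := rho_increment (@mero_continuous F _) rF (mero_derivable rF) e2.
  move=> /(near_line v1); apply: filterS => s; rewrite incr D0 add0r.
  by rewrite mulrCA divff ?mulr1.
Qed.

(** Constancy on horizontal lines makes the complex derivative zero at every
    finite value, since it can be computed along the real direction; so the
    function does not vary along vertical lines either. *)
Lemma ae_affine_sder0_cst F :
  {ae mu, forall y : R, {ae mu, forall x : R, affine_sder F (x +i* y) = 0}} ->
  forall z, F z = F 0.
Proof.
move=> ae0.
have xyE (x y : R) : x +i* y = (0 +i* y) + x%:C * 1.
  by rewrite mulr1; apply/eqP; rewrite eq_complex/= add0r addr0 !eqxx.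
have good : {ae mu, forall y : R, forall x, F (x +i* y) = F (0 +i* y)}.
  move: ae0; apply: negligibleS => y /=; apply: contra_not => y0 x.
  rewrite xyE; apply: (line_cst _ y0); first by rewrite normc1.
  by move=> t /contrapT /=; rewrite -xyE.
have horiz x y : F (x +i* y) = F (0 +i* y).
  (* a defect at height [y] would persist on a whole interval of heights *)
  have [//|Fxy] := pselect (F (x +i* y) = F (0 +i* y)).
  have d0 : 0 < rho (F (x +i* y)) (F (0 +i* y)) / 3.
    by rewrite divr_gt0// rho_gt0; apply/eqP.
  have vert a : \forall s \near y, rho (F (a +i* y)) (F (a +i* s)) <
      rho (F (x +i* y)) (F (0 +i* y)) / 3.
    have imE (s : R) : a +i* s = (a +i* 0) + s%:C * 'i.
      by apply/eqP; rewrite eq_complex/= !(mul0r, mulr0, mulr1, subr0, addr0, add0r) !eqxx.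
    have := near_line (z := a +i* 0) (v := 'i) (t := y)
      (P := fun w => rho (F (a +i* y)) (F w) < rho (F (x +i* y)) (F (0 +i* y)) / 3).
    rewrite -imE => H; have : \forall s \near y, rho (F (a +i* y))
      (F (a +i* 0 + s%:C * 'i)) < rho (F (x +i* y)) (F (0 +i* y)) / 3.
      apply: H; first by rewrite normc_imag normr1.
      by have /cvg_sphereP := @mero_continuous F (a +i* y); apply.
    by apply: filterS => s; rewrite -imE.
  have /nbhs_ballP[r /= r0 rP] : \forall s \near y, F (x +i* s) <> F (0 +i* s).
    apply: filterS2 (vert x) (vert 0) => s h1 h2 e.
    have := rho_triangle (F (x +i* s)) (F (x +i* y)) (F (0 +i* y)).
    by rewrite -e (rho_sym (F (0 +i* y))) in h2; lra.
  have : mu.-negligible (ball y r).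
    by apply: negligibleS good => s /rP h /(_ x).
  move=> /(@measure_negligible _ _ _ mu _ (measurable_ball y r)).
  rewrite [LHS]lebesgue_measure_ball ?(ltW r0)// => /eqP.
  by rewrite eqe mulrn_eq0/= gt_eqF.
have sder0 z : affine_sder F z = 0.
  have [Fz|Fz] := pselect (F z = None); first by rewrite /affine_sder Fz eqxx.
  pose w n : plane R := z + (harmonic n)%:C.
  have wz n : w n != z.
    by rewrite /w -subr_eq0 addrAC subrr add0r fmorph_eq0 gt_eqF// harmonic_gt0.
  have cw : w n @[n --> \oo] --> z.
    move=> A /nbhs_planeP[r r0 rP].
    have := @cvg_harmonic R; move=> /cvgrPdist_lt/(_ _ r0); apply: filterS => n.
    rewrite sub0r normrN => h; apply: rP.
    by rewrite /w addrAC subrr add0r normc_real.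
  have := cvg_affine_sder Fz wz cw.
  have -> : (fun n => sin (rho (F (w n)) (F z)) / normc (w n - z)) = cst 0.
    apply/funext => n; rewrite [F (w n)](_ : _ = F z) ?rhoxx ?sin0 ?mul0r//.
    by rewrite /w; case: (z) => x y; rewrite [LHS]horiz [RHS]horiz addr0.
  by move=> /cvg_unique; apply => //; exact: cvg_cst.
move=> [x y]; rewrite horiz.
have -> : 0 +i* y = 0 + y%:C * (0 +i* 1) :> R[i].
  by rewrite add0r; apply/eqP; rewrite eq_complex/= !(mul0r, mulr0, mulr1, subr0, addr0, add0r)
    oppr0 !eqxx.
apply: (@line_cst F 0 (0 +i* 1) set0); first by rewrite normc_imag normr1.
  exact: negligible_set0.
by move=> t _; exact: sder0.
Unshelve. all: by end_near. Qed.

End Rigidity.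

(** * Measurability on the space of meromorphic functions *)
Section Caratheodory.
Context d (X : measurableType d) (R : realType).

Let grid (m : nat) (t : R) : R := (Num.floor (t * m.+1%:R))%:~R / m.+1%:R.

Let cvg_grid t : grid m t @[m --> \oo] --> t.
Proof.
apply/cvgrPdist_lt => e e0; near=> m.
have m0 : 0 < m.+1%:R :> R by rewrite ltr0n.
have /andP[h1 h2] := floor_itv (t * m.+1%:R).
have h3 : grid m t <= t by rewrite /grid ler_pdivrMr.
have h4 : t < grid m t + m.+1%:R^-1.
  by rewrite /grid -[X in _ + X]mul1r -mulrDl ltr_pdivlMr// -intrD1.
rewrite ger0_norm ?subr_ge0// ltrBlDl (lt_trans h4)// ltrD2l.
by near: m; exact: near_infty_natSinv_lt (PosNum e0).
Unshelve. all: by end_near. Qed.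

(** The grid values [grid m t] tend to [t], so [h x t] is the limit of
    [h x (grid m t)], which is constant in [t] on each of countably many
    intervals. *)
Lemma measurable_caratheodory (h : X -> R -> R) :
  (forall t, measurable_fun setT (h^~ t)) -> (forall x, continuous (h x)) ->
  measurable_fun setT (fun q : X * R => h q.1 q.2).
Proof.
move=> mh ch.
apply: (@measurable_fun_cvg _ _ _ setT (fun m q => h q.1 (grid m q.2))).
  move=> m _ B mB; rewrite setTI.
  pose C (k : int) : set (X * R) := (h^~ (k%:~R / m.+1%:R) @^-1` B) `*`
    `[k%:~R / m.+1%:R, (k + 1)%:~R / m.+1%:R[%classic.
  have -> : (fun q => h q.1 (grid m q.2)) @^-1` B = \bigcup_k C k.
    have m0 : 0 < m.+1%:R :> R by rewrite ltr0n.
    apply/seteqP; split => -[x t] /=.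
      move=> Bx; exists (Num.floor (t * m.+1%:R)) => //; split => //=.
      rewrite in_itv/= ler_pdivrMr// ltr_pdivlMr//.
      exact: floor_itv.
    move=> [k _ [/= Bx]]; rewrite in_itv/= ler_pdivrMr// ltr_pdivlMr// => kt.
    by rewrite /grid (floor_def kt).
  apply: countable_bigcupT_measurable => [|k]; first exact: countableP.
  apply: measurableX; last exact: measurable_itv.
  by rewrite -[X in measurable X]setTI; exact: mh.
move=> q _; apply: (@cvg_comp _ _ _ (grid^~ q.2) (h q.1) _ (nbhs q.2)).
  exact: cvg_grid.
exact: ch.
Qed.

End Caratheodory.

Section Measurability.
Variable R : realType.
Local Notation rho := (@spherical_dist R).
Implicit Types F : merofun R.

Lemma measurable_open (U : set (merofun R)) : open U ->
  measurable (U : set (borel_merofun R)).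
Proof. by move=> oU; exact: sub_sigma_algebra. Qed.

Lemma near_uniform F (A : set (plane R)) (E : set (riemann_sphere R * riemann_sphere R)) :
  compact A -> entourage E -> \forall G \near F, forall y, A y ->
    E (F y, mero_eval G y).
Proof.
move=> cA entE.
have := @fam_nbhs (plane R) (riemann_sphere R) compact A E (set_val F) entE cA.
exact: initial_continuous.
Qed.

Lemma near_eval F z (e : R) : 0 < e -> \forall G \near F, rho (F z) (mero_eval G z) < e.
Proof.
move=> e0.
have := @near_uniform F [set z] [set pq | rho pq.1 pq.2 < e] (@compact_set1 _ z).
move=> /(_ _)/wrap[]; last by apply: filterS => G /(_ z erefl).
exact: (@entourage_ball R (riemann_sphere R) (PosNum e0)).
Qed.

Lemma measurable_continuous (phi : merofun R -> R) : continuous phi ->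
  measurable_fun setT (phi : borel_merofun R -> R).
Proof.
move=> cphi; apply: (measurability _ (RGenOInfty.measurableE R)) => //.
move=> _ [_ [x ->] <-]; rewrite setTI; apply: measurable_open.
by move/continuousP : cphi; apply; rewrite set_itvE; exact: open_gt.
Qed.

Lemma measurable_rho_eval z (p : riemann_sphere R) :
  measurable_fun setT (fun F : borel_merofun R => rho (mero_eval F z) p).
Proof.
apply: (measurable_continuous (phi := fun F => rho (F z) p)) => F.
have FF : Filter (nbhs F) by exact: (@nbhs_filter (merofun R)).
apply/(@cvgrPdist_lt _ _ _ (nbhs F) FF) => e e0; apply: filterS (near_eval F z e0) => G.
exact: le_lt_trans (rho_lip _ _ _).
Qed.

Lemma continuous_rho_eval2 z w :
  continuous (fun F : merofun R => rho (F z) (F w)).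
Proof.
move=> F; have FF : Filter (nbhs F) by exact: (@nbhs_filter (merofun R)).
apply/(@cvgrPdist_lt _ _ _ (nbhs F) FF) => e e0.
have e2 : 0 < e / 2 by rewrite divr_gt0.
apply: filterS2 (near_eval F z e2) (near_eval F w e2) => G Gz Gw.
have := rho_lip (mero_eval F z) (G z) (mero_eval F w).
have := rho_lip (mero_eval F w) (G w) (G z).
rewrite (rho_sym (mero_eval F w) (G z)) (rho_sym (G w)) !ler_norml ltr_norml.
by move=> /andP[? ?] /andP[? ?]; apply/andP; split; lra.
Qed.

Lemma measurable_rho_eval2 z w :
  measurable_fun setT
    (fun F : borel_merofun R => rho (mero_eval F z) (mero_eval F w)).
Proof. exact: measurable_continuous (@continuous_rho_eval2 z w). Qed.

(** Uniform closeness on a compact set of the translates is uniform closeness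
    of the functions on the translated compact set. *)
Lemma continuous_translate (w : plane R) : continuous (translate w).
Proof.
apply: (@continuous_comp_initial _ _ _ set_val) => F.
have FF : Filter (nbhs F) by exact: nbhs_filter.
apply/fam_cvgP => A cA Q /= /uniform_nbhs[E [entE EQ]].
have cAw : compact [set y + w | y in A].
  apply: continuous_compact => //; apply: continuous_subspaceT => y.
  have yF : Filter (nbhs (y : plane R)) by exact: nbhs_filter.
  exact: (cvgD (@cvg_id _ _) (@cvg_cst (plane R) w _ _ yF)).
have := near_uniform F cAw entE; apply: filterS => G FG.
by apply: EQ => y Ay /=; apply: FG; exists y.
Qed.

Lemma measurable_translate w :
  measurable_fun setT (translate w : borel_merofun R -> borel_merofun R).
Proof.
apply: (@measurability _ _ (borel_merofun R) (borel_merofun R) setT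
  (translate w) (@open (merofun R))) => // _ [U oU <-].
rewrite setTI; apply: measurable_open.
by move/continuousP : (@continuous_translate w); apply.
Qed.

Local Notation plane_of p := (p.1 +i* p.2).

Lemma continuous_horizontal F (x y : R) : F (s +i* y) @[s --> x] --> F (x +i* y).
Proof.
have E s : s +i* y = (0 +i* y) + s%:C * 1.
  by rewrite mulr1; apply/eqP; rewrite eq_complex/= add0r addr0 !eqxx.
rewrite E => A /mero_continuous /(near_line (normc1 R)).
by apply: filterS => s; rewrite -E.
Qed.

Lemma continuous_vertical F (x y : R) : F (x +i* s) @[s --> y] --> F (x +i* y).
Proof.
have E s : x +i* s = (x +i* 0) + s%:C * 'i.
  by apply/eqP; rewrite eq_complex/= !(mul0r, mulr0, mulr1, subr0, addr0, add0r) !eqxx.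
have v1 : normc 'i = 1 :> R by rewrite normc_imag normr1.
rewrite E => A /mero_continuous /(near_line v1).
by apply: filterS => s; rewrite -E.
Qed.

(** One coordinate of the plane is adjoined to the parameter space at a time,
    so that continuity along coordinate lines suffices. *)
Lemma measurable_joint (h : merofun R -> plane R -> R) :
  (forall z, measurable_fun setT (h^~ z : borel_merofun R -> R)) ->
  (forall F (x y : R), h F (s +i* y) @[s --> x] --> h F (x +i* y)) ->
  (forall F (x y : R), h F (x +i* s) @[s --> y] --> h F (x +i* y)) ->
  measurable_fun setT
    (fun q : borel_merofun R * (R * R) => h q.1 (plane_of q.2)).
Proof.
move=> mh ch cv.
have m1 (y : R) : measurable_fun setT
    (fun q : borel_merofun R * R => h q.1 (q.2 +i* y)).
  apply: (measurable_caratheodory (h := fun (F : borel_merofun R) x => h F (x +i* y))).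
    by move=> x; exact: mh.
  by move=> F x; exact: ch.
have m2 := @measurable_caratheodory _ _ R
  (fun (q : borel_merofun R * R) y => h q.1 (q.2 +i* y)) m1 (fun q y => cv q.1 q.2 y).
have ma : measurable_fun setT
    (fun q : borel_merofun R * (R * R) => ((q.1, q.2.1), q.2.2)).
  apply: measurable_fun_pair; last exact: measurableT_comp.
  by apply: measurable_fun_pair => //; exact: measurableT_comp.
exact: (measurableT_comp m2 ma).
Qed.

Lemma cvg_rho (T : Type) (G : set_system T) (FG : Filter G)
    (f g : T -> riemann_sphere R) p q :
  f @ G --> p -> g @ G --> q -> rho (f t) (g t) @[t --> G] --> rho p q.
Proof.
move=> /cvg_sphereP fp /cvg_sphereP gq; apply/cvgrPdist_lt => e e0.
have e2 : 0 < e / 2 by rewrite divr_gt0.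
apply: filterS2 (fp _ e2) (gq _ e2) => t ft gt.
have := rho_lip p (f t) q; have := rho_lip q (g t) (f t).
rewrite (rho_sym q (f t)) (rho_sym (g t)) !ler_norml ltr_norml.
by move=> /andP[? ?] /andP[? ?]; apply/andP; split; lra.
Qed.

Lemma measurable_rho_joint (c : R) : measurable_fun setT
  (fun q : borel_merofun R * (R * R) =>
    rho (mero_eval q.1 (plane_of q.2 + c%:C)) (mero_eval q.1 (plane_of q.2))).
Proof.
have addE (x y : R) : (x +i* y) + c%:C = (x + c) +i* y.
  by apply/eqP; rewrite eq_complex/= addr0 !eqxx.
apply: (@measurable_joint (fun F z => rho (F (z + c%:C)) (F z))).
- by move=> z; exact: measurable_rho_eval2.
- move=> F x y; apply: cvg_rho; last exact: continuous_horizontal.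
  rewrite addE; under eq_fun do rewrite addE.
  apply: (@cvg_comp _ _ _ (fun s => s + c) (fun s => F (s +i* y)) _ (nbhs (x + c))).
    by apply: cvgD; [exact: cvg_id|exact: cvg_cst].
  exact: continuous_horizontal.
- move=> F x y; apply: cvg_rho; last exact: continuous_vertical.
  rewrite addE; under eq_fun do rewrite addE.
  exact: continuous_vertical.
Qed.

Lemma measurable_rho_infty : measurable_fun setT
  (fun q : borel_merofun R * (R * R) => rho (mero_eval q.1 (plane_of q.2)) None).
Proof.
apply: (@measurable_joint (fun F z => rho (F z) None)).
- by move=> z; exact: measurable_rho_eval.
- move=> F x y; apply: cvg_rho; last exact: cvg_cst.
  exact: continuous_horizontal.
- move=> F x y; apply: cvg_rho; last exact: cvg_cst.
  exact: continuous_vertical.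
Qed.

Lemma measurable_affine_sder : measurable_fun setT
  (fun q : borel_merofun R * (R * R) => affine_sder q.1 (plane_of q.2)).
Proof.
pose A : set (borel_merofun R * (R * R)) :=
  [set q | rho (mero_eval q.1 (plane_of q.2)) None != 0].
have mA : measurable A.
  have := measurable_rho_infty measurableT (measurableC (measurable_set1 (0 : R))).
  rewrite setTI; congr measurable.
  by apply/seteqP; split => q /=; [move/eqP|move/eqP].
pose h n (q : borel_merofun R * (R * R)) : R := \1_A q *
  (sin (rho (mero_eval q.1 (plane_of q.2 + (harmonic n)%:C))
            (mero_eval q.1 (plane_of q.2))) / harmonic n).
apply: (@measurable_fun_cvg _ _ _ setT h).
  move=> n; apply: measurable_funM; first exact: measurable_indic.
  apply: measurable_funM; last exact: measurable_cst.
  apply: measurableT_comp; last exact: measurable_rho_joint.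
  exact: (continuous_measurable_fun (@continuous_sin R)).
move=> q _; rewrite /h; set z : plane R := plane_of q.2.
have [Fz|Fz] := pselect (mero_eval q.1 z = None).
  have -> : affine_sder q.1 z = 0 by rewrite /affine_sder Fz eqxx.
  have -> : \1_A q = 0 :> R.
    by rewrite indicE memNset// /A /= Fz rhoxx eqxx.
  by under eq_fun do rewrite mul0r; exact: cvg_cst.
have -> : \1_A q = 1 :> R.
  by rewrite indicE mem_set// /A /= gt_eqF// rho_gt0; apply/eqP.
under eq_fun do rewrite mul1r.
pose w n : plane R := z + (harmonic n)%:C.
have wz n : w n != z.
  by rewrite /w -subr_eq0 addrAC subrr add0r fmorph_eq0 gt_eqF// harmonic_gt0.
have wE n : normc (w n - z) = harmonic n.
  by rewrite /w addrAC subrr add0r normc_real ger0_norm// harmonic_ge0.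
have cw : w n @[n --> \oo] --> z.
  move=> B /nbhs_planeP[r r0 rP].
  have /cvgrPdist_lt/(_ _ r0) := @cvg_harmonic R; apply: filterS => n.
  by rewrite sub0r normrN => h1; apply: rP; rewrite wE (le_lt_trans (ler_norm _)).
have := cvg_affine_sder Fz wz cw.
by under eq_fun do rewrite wE.
Qed.

End Measurability.

(** * Spherical area and translations *)
Section IntegralMonotone.
Local Open Scope ereal_scope.
Context d (T : measurableType d) (R : realType).
Variable mu : {measure set T -> \bar R}.

Import HBNNSimple.

(** The integral of a nonnegative function is a supremum over simple functions
    below it, so monotonicity holds without measurability.  It is applied with
    [spherical_derivative], whose values at poles are limits, and with areas
    of discs as functions of the radius. *)
Lemma ge0_le_integral_nonmeasurable (D1 D2 : set T) (f g : T -> \bar R) :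
  D1 `<=` D2 -> (forall x, D2 x -> 0 <= g x) ->
  (forall x, D1 x -> 0 <= f x) -> (forall x, D1 x -> f x <= g x) ->
  \int[mu]_(x in D1) f x <= \int[mu]_(x in D2) g x.
Proof.
move=> D12 g0 f0 fg; rewrite !ge0_integralE//.
apply: ereal_sup_le => _ [h hf <-]; exists h => //= x; apply: (le_trans (hf x)); rewrite !patchE.
case: ifPn => [/set_mem D1x|_]; first by rewrite mem_set ?fg//; exact: D12.
by case: ifPn => [/set_mem/g0|].
Qed.

End IntegralMonotone.

Section Shift.
Variable R : realType.
Local Notation mu := (@lebesgue_measure R).

Lemma measurable_shift1 (a : R) :
  measurable_fun setT ((fun x => x + a) : R -> measurableTypeR R).
Proof. by apply: measurable_funD => //; exact: measurable_cst. Qed.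

Lemma lebesgue_measure_shift (a : R) (A : set R) : measurable A ->
  mu ((fun x => x + a) @^-1` A) = mu A.
Proof.
move=> mA.
pose f : measurableTypeR R -> measurableTypeR R := fun x => (x : R) + a.
rewrite -[LHS]/(pushforward mu f A).
apply/esym/lebesgue_measure_unique => //=; first exact: measurable_shift1.
move=> mf _ [[u v]] _ <-.
rewrite /pushforward /=.
have -> : (fun x => x + a) @^-1` `]u, v]%classic = `]u - a, v - a]%classic.
  by apply/seteqP; split => x /=; rewrite !in_itv/= ltrBlDr lerBrDr.
rewrite !lebesgue_measure_itv/= !lte_fin ltrD2r.
by case: ifP => // _; rewrite -!EFinB; congr EFin; ring.
Qed.

Definition shift2 (a b : R) (p : measurableTypeR R * measurableTypeR R) :
    measurableTypeR R * measurableTypeR R := (p.1 + a, p.2 + b).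

Lemma measurable_shift2 a b : measurable_fun setT (shift2 a b).
Proof.
apply: measurable_fun_pair; apply: measurable_funD => //; exact: measurable_cst.
Qed.

Lemma lebesgue_measure2_shift (a b : R) (A : set (R * R)) : measurable A ->
  (mu \x mu)%E (shift2 a b @^-1` A) = (mu \x mu)%E A.
Proof.
move=> mA.
rewrite -[LHS]/(pushforward (mu \x mu)%E (shift2 a b) A).
apply/esym; apply: (@product_measure_unique _ _ _ _ R mu mu) => //.
  exact: measurable_shift2.
move=> ms B C mB mC.
rewrite -[LHS]/((mu \x mu)%E
  (((fun x : R => x + a) @^-1` B) `*` ((fun x : R => x + b) @^-1` C))).
rewrite product_measure1E.
- by congr (_ * _)%E; exact: lebesgue_measure_shift.
- by rewrite -[X in measurable X]setTI; exact: measurable_shift1.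
- by rewrite -[X in measurable X]setTI; exact: measurable_shift1.
Qed.

Lemma integral_shift2 (a b : R) (f : R * R -> \bar R) (D : set (R * R)) :
  measurable D -> measurable_fun setT f -> (forall p, (0 <= f p)%E) ->
  (\int[mu \x mu]_(p in shift2 a b @^-1` D) f (shift2 a b p) =
   \int[mu \x mu]_(p in D) f p)%E.
Proof.
move=> mD mf f0.
have := @ge0_integral_pushforward _ _ _ _ R _ (measurable_shift2 a b)
  (mu \x mu)%E D f mD (measurable_funS measurableT (@subsetT _ D) mf)
  (fun p _ => f0 p).
move=> /esym H; rewrite [LHS]H.
apply: eq_measure_integral; first exact: measurable_shift2.
move=> ms A mA _.
by rewrite -[LHS]/((mu \x mu)%E (shift2 a b @^-1` A)) lebesgue_measure2_shift.
Qed.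

End Shift.

Section Area.
Variable R : realType.
Local Notation mu := (@lebesgue_measure R).
Implicit Types F : merofun R.
Local Notation plane_of p := (p.1 +i* p.2).

Definition area F (D : set (R * R)) : \bar R :=
  (\int[mu \x mu]_(p in D) (affine_sder F (plane_of p) ^+ 2)%:E)%E.

Lemma measurable_affine_sder2 F :
  measurable_fun setT (fun p : R * R => (affine_sder F (plane_of p) ^+ 2)%:E).
Proof.
apply/measurable_EFinP; apply: measurable_funX.
exact: (@measurable_fun_pair2 _ _ _ (borel_merofun R) (R * R)%type R
  (fun q => affine_sder q.1 (plane_of q.2)) F (@measurable_affine_sder R)).
Qed.

Lemma derive1_translate (f : plane R -> plane R) (w z : plane R) :
  derive1 (fun u => f (u + w)) z = derive1 f (z + w).
Proof.
rewrite !derive1E /derive; set g := (X in lim (X @ _)); set k := (X in _ = lim (X @ _)).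
suff -> : g = k by [].
by apply/funext => h; rewrite /g /k /= addrA.
Qed.

Lemma affine_sder_translate w F z : affine_sder (translate w F) z = affine_sder F (z + w).
Proof.
transitivity (if F (z + w) == None then 0 else
  normc (derive1 (fun u : plane R => (@finite_part R \o F) (u + w)) z) /
    (1 + normc (finite_part (F (z + w))) ^+ 2)); first by [].
by rewrite derive1_translate.
Qed.

Lemma area_translate F (a b : R) (D : set (R * R)) : measurable D ->
  area (translate (a +i* b) F) (shift2 a b @^-1` D) = area F D.
Proof.
move=> mD; rewrite /area.
rewrite -(integral_shift2 a b mD (measurable_affine_sder2 F)); last first.
  by move=> p; rewrite lee_fin exprn_ge0// affine_sder_ge0.
apply: eq_integral => p _; rewrite affine_sder_translate.
by congr ((affine_sder _ _ ^+ 2)%:E).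
Qed.

End Area.

Section Boxes.
Variable R : realType.
Local Notation mu := (@lebesgue_measure R).
Implicit Types (F : merofun R) (K : R).
Local Notation plane_of p := (p.1 +i* p.2).

(** Cells are half-open of length [2 * K] and centred at the even multiples of
    [K]; they tile the half-line to the right of [- K], and the cell of index 0
    is symmetric, so that [box K 0 0] exhausts the plane as [K] grows. *)
Definition cell K (i : nat) : set R :=
  `[(i%:R * 2 - 1) * K, (i%:R * 2 + 1) * K[%classic.

Definition box K (i j : nat) : set (R * R) := cell K i `*` cell K j.

Lemma measurable_box K i j : measurable (box K i j).
Proof. by apply: measurableX; exact: measurable_itv. Qed.

Lemma cell_shift K i : (fun x => x + 2 * K) @^-1` cell K i.+1 = cell K i.
Proof.
apply/seteqP; split => x; rewrite /cell /= !in_itv/= -natr1 => /andP[h1 h2];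
  by apply/andP; split; lra.
Qed.

Lemma cell_inj K i i' x : 0 < K -> cell K i x -> cell K i' x -> i = i'.
Proof.
move=> K0; wlog ii' : i i' / (i < i')%N => [H|].
  by have [/H|/H H1 a b|//] := ltngtP i i'; last exact/esym/H1.
rewrite /cell /= !in_itv/= => /andP[_ h1] /andP[h2 _].
have : (i%:R * 2 + 1) * K <= (i'%:R * 2 - 1) * K.
  rewrite ler_pM2r//; have : i.+1%:R <= i'%:R :> R by rewrite ler_nat.
  by rewrite -natr1; lra.
by move=> /(lt_le_trans h1) /lt_le_trans/(_ h2); rewrite ltxx.
Qed.

Lemma cell_bound K i n x : 0 < K -> (i < n)%N -> cell K i x -> `|x| < n%:R * (2 * K).
Proof.
move=> K0 iN; rewrite /cell /= in_itv/= => /andP[h1 h2].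
have h3 : (i%:R + 1) * K <= n%:R * K.
  by rewrite ler_pM2r// natr1 ler_nat.
have h4 : 0 <= i%:R * K by rewrite mulr_ge0// ltW.
rewrite ltr_norml; lra.
Qed.

Lemma normc_le_add (x y : R) : normc (x +i* y) <= `|x| + `|y|.
Proof.
have -> : x +i* y = x%:C + (0 +i* y).
  by apply/eqP; rewrite eq_complex/= addr0 add0r !eqxx.
by rewrite (le_trans (normcD _ _))// normc_real normc_imag.
Qed.

Definition step_right K : merofun R -> merofun R := translate ((2 * K) +i* 0).
Definition step_up K : merofun R -> merofun R := translate (0 +i* (2 * K)).

(** Translating the function by one step amounts to moving the square to its
    neighbour; this converts orbit sums into areas of disjoint squares. *)
Lemma area_iter_right F K i i0 j0 :
  area (iter i (step_right K) F) (box K i0 j0) = area F (box K (i + i0) j0).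
Proof.
elim: i i0 => [//|i IH] i0; rewrite iterS addSnnS -IH.
have <- : shift2 (2 * K) 0 @^-1` box K i0.+1 j0 = box K i0 j0.
  rewrite /box -[in RHS](cell_shift K i0).
  by apply/seteqP; split => -[x y]; rewrite /= addr0.
exact: (area_translate _ _ _ (measurable_box _ _ _)).
Qed.

Lemma area_iter_up F K j i0 j0 :
  area (iter j (step_up K) F) (box K i0 j0) = area F (box K i0 (j + j0)).
Proof.
elim: j j0 => [//|j IH] j0; rewrite iterS addSnnS -IH.
have <- : shift2 0 (2 * K) @^-1` box K i0 j0.+1 = box K i0 j0.
  rewrite /box -[in RHS](cell_shift K j0).
  by apply/seteqP; split => -[x y]; rewrite /= addr0.
exact: (area_translate _ _ _ (measurable_box _ _ _)).
Qed.

Lemma affine_sder_sqr_le F z :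
  affine_sder F z ^+ 2 <= spherical_derivative F z ^+ 2.
Proof.
rewrite /affine_sder /spherical_derivative; case: ifP => // _.
by rewrite expr0n sqr_ge0.
Qed.

(** The squares of index less than [n] in both directions are disjoint and lie
    in the disc of radius [4 * K * n]. *)
Lemma sum_area_le F K n : 0 < K ->
  (\sum_(j < n) \sum_(i < n) area F (box K i j) <=
   \int[mu \x mu]_(p in [set p : R * R | (normc (p.1 +i* p.2) < n%:R * (4 * K))%R])
      (spherical_derivative F (p.1 +i* p.2) ^+ 2)%:E)%E.
Proof.
move=> K0; rewrite pair_big/=.
pose bx (q : 'I_n * 'I_n) := box K q.2 q.1.
rewrite /area -(@ge0_integral_bigsetU _ _ _ (mu \x mu)%E _ bx)/=; last first.
- by move=> p _; rewrite lee_fin sqr_ge0.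
- exact: measurable_funS (measurable_affine_sder2 F).
- apply/trivIsetP => -[j i] [j' i'] _ _ /eqP ne.
  apply/seteqP; split => // -[x y] [[/= xi yj] [/= xi' yj']]; apply: ne.
  congr pair; apply: val_inj => /=.
    exact: (cell_inj K0 yj yj').
  exact: (cell_inj K0 xi xi').
- exact: index_enum_uniq.
- by move=> q; exact: measurable_box.
apply: ge0_le_integral_nonmeasurable.
- rewrite -bigcup_seq => -[x y] [[j i] _ [/= xi yj]].
  apply: (le_lt_trans (normc_le_add _ _)).
  have := cell_bound K0 (ltn_ord i) xi; have := cell_bound K0 (ltn_ord j) yj.
  lra.
- by move=> p _; rewrite lee_fin sqr_ge0.
- by move=> p _; rewrite lee_fin sqr_ge0.
by move=> p _; rewrite lee_fin affine_sder_sqr_le.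
Qed.

(** Tonelli, one coordinate of the plane at a time. *)
Lemma measurable_area (D : set (R * R)) : measurable D ->
  measurable_fun setT (fun F : borel_merofun R => area F D).
Proof.
move=> mD.
pose f (q : borel_merofun R * (R * R)) : \bar R :=
  (\1_D q.2 * affine_sder q.1 (plane_of q.2) ^+ 2)%:E.
have mf : measurable_fun setT f.
  apply/measurable_EFinP; apply: measurable_funM.
    by apply: measurableT_comp => //; exact: measurable_indic.
  by apply: measurable_funX; exact: measurable_affine_sder.
have f0 q : (0 <= f q)%E by rewrite lee_fin mulr_ge0 ?sqr_ge0.
pose g (r : (borel_merofun R * R) * R) : \bar R := f (r.1.1, (r.1.2, r.2)).
have mg : measurable_fun setT g.
  apply: (measurableT_comp mf); apply: measurable_fun_pair.
    by apply: measurableT_comp => //; exact: measurable_fst.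
  apply: measurable_fun_pair => //.
  by apply: measurableT_comp => //; exact: measurable_snd.
have mG := @measurable_fun_fubini_tonelli_F _ _ _ _ R mu g mg (fun r => f0 _).
have mH := @measurable_fun_fubini_tonelli_F _ _ _ _ R mu (fubini_F mu g) mG
  (fun r => integral_ge0 _ (fun y _ => f0 _)).
move: mH; congr measurable_fun; apply/funext => F.
rewrite /area integral_mkcond.
transitivity (\int[mu \x mu]_p f (F, p))%E.
  rewrite (@fubini_tonelli1 _ _ _ _ R mu mu (fun p => f (F, p)))//.
  exact: (measurable_fun_pair2 (F : borel_merofun R) mf).
apply: eq_integral => p _.
rewrite /f /= patchE indicE; case: ifPn => pD; first by rewrite mul1r.
by rewrite mul0r.
Qed.

End Boxes.

(** * From quadratic area growth to the characteristic *)
Section Growth.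
Variable R : realType.
Local Notation mu := (@lebesgue_measure R).
Implicit Types (F : merofun R).

Local Notation disc t := [set p : R * R | (normc (p.1 +i* p.2) < t)%R].
Local Notation spherical_area F t :=
  (\int[mu \x mu]_(p in disc t) (spherical_derivative F (p.1 +i* p.2) ^+ 2)%:E)%E.

Lemma spherical_area_ge0 F t : (0 <= spherical_area F t)%E.
Proof. by apply: integral_ge0 => p _; rewrite lee_fin sqr_ge0. Qed.

Lemma spherical_area_nd F s t : s <= t -> (spherical_area F s <= spherical_area F t)%E.
Proof.
move=> st; apply: ge0_le_integral_nonmeasurable => //.
- by move=> p /= /lt_le_trans; apply.
- by move=> p _; rewrite lee_fin sqr_ge0.
- by move=> p _; rewrite lee_fin sqr_ge0.
Qed.

Lemma limf_einf_ge (f : R -> \bar R) (r0 : R) (a : \bar R) :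
  (forall r, r0 <= r -> (a <= f r)%E) -> (a <= limf_einf f (pinfty_nbhs R))%E.
Proof.
move=> H; rewrite limf_einfE.
apply: (@le_trans _ _ (ereal_inf (f @` [set r | r0 <= r]))).
  by apply: le_ereal_inf_tmp => _ [r /= r0r <-]; exact: H.
apply: ereal_sup_ubound => /=; exists [set r | r0 <= r] => //.
by exists r0; split; [exact: num_real|move=> x /ltW].
Qed.

(** Interpolation between the radii [n * b]: for [t >= b] the integer part of
    [t / b] is at least half of [t / b], and areas of discs are nondecreasing. *)
Lemma quadratic_area_growth F (b c : R) : 0 < b -> 0 < c ->
  (forall n, ((c * n%:R ^+ 2)%:E <= spherical_area F (n%:R * b))%E) ->
  forall t, b <= t -> ((c * (t / (2 * b)) ^+ 2)%:E <= spherical_area F t)%E.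
Proof.
move=> b_gt0 c0 H t rt; pose n := Num.truncn (t / b).
have t0 : 0 < t by exact: lt_le_trans rt.
have tr1 : 1 <= t / b by rewrite ler_pdivlMr// mul1r.
have /andP[n1 n2] : n%:R <= t / b < n.+1%:R.
  by apply: truncn_itv; rewrite divr_ge0 ?ltW.
have n0 : (0 < n)%N by rewrite /n truncn_gt0.
apply: (@le_trans _ _ (c * n%:R ^+ 2)%:E).
  rewrite lee_fin ler_pM2l// ler_pXn2r ?nnegrE ?divr_ge0 ?mulr_ge0 ?(ltW t0) ?(ltW b_gt0)//.
  have -> : t / (2 * b) = (t / b) / 2 by field; rewrite gt_eqF.
  have : 1 <= n%:R :> R by rewrite ler1n.
  rewrite ler_pdivrMr//; move: n2; rewrite -natr1; lra.
apply: (le_trans (H n)); apply: spherical_area_nd.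
by rewrite -ler_pdivlMr.
Qed.

(** If the area over the disc of radius [t] is at least a multiple of [t ^ 2],
    the integrand of the characteristic is at least a multiple of [t]; the part
    of the integral over [r / 2 < t <= r] alone is then at least a multiple of
    [r ^ 2]. *)
Lemma characteristic_liminf_gt0 F (b c : R) : 0 < b -> 0 < c ->
  (forall n, ((c * n%:R ^+ 2)%:E <= spherical_area F (n%:R * b))%E) ->
  (0 < limf_einf (fun r : R => nevanlinna_characteristic F r * (r ^- 2)%:E)
         (pinfty_nbhs R))%E.
Proof.
move=> b_gt0 c0 H; have G := quadratic_area_growth b_gt0 c0 H.
pose k : R := c / (4 * pi * b ^+ 2).
have kE (t : R) : 0 < t ->
    pi^-1 * (c * (t / (2 * b)) ^+ 2) * t^-1 = k * t.
  by move=> t0; rewrite /k; have := pi_gt0 R; move: (pi : R) => q q0; field; rewrite !gt_eqF.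
have k0 : 0 < k by rewrite divr_gt0// !mulr_gt0// ?pi_gt0// exprn_gt0.
apply: (@lt_le_trans _ _ (k / 4)%:E); first by rewrite lte_fin divr_gt0.
apply: (@limf_einf_ge _ (2 * b)) => r rr.
have r0 : 0 < r by apply: lt_le_trans rr; rewrite mulr_gt0.
suff : ((k * r / 2 * (r / 2))%:E <= nevanlinna_characteristic F r)%E.
  move=> K; apply: (@le_trans _ _ ((k * r / 2 * (r / 2))%:E * (r ^- 2)%:E)%E).
    rewrite -EFinM lee_fin; have -> // : k * r / 2 * (r / 2) * r ^- 2 = k / 4.
    by field; rewrite gt_eqF.
  by apply: lee_wpmul2r => //; rewrite lee_fin invr_ge0 exprn_ge0 ?ltW.
have -> : ((k * r / 2 * (r / 2))%:E = \int[mu]_(t in `](r / 2)%R, r]) (k * r / 2)%:E)%E.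
  rewrite integral_cst//= lebesgue_measure_itv/= lte_fin ifT; last first.
    by rewrite ltr_pdivrMr// ltr_pMr// ltr1n.
  by rewrite -EFinB -EFinM; congr (_ * _)%:E; field.
apply: ge0_le_integral_nonmeasurable => t /=; rewrite ?in_itv/=.
- move=> /andP[h1 ->]; rewrite andbT; apply: le_lt_trans h1.
  by rewrite divr_ge0// ltW.
- move=> /andP[h1 _]; rewrite mule_ge0//; last by rewrite lee_fin invr_ge0 ltW.
  by rewrite mule_ge0 ?spherical_area_ge0// lee_fin invr_ge0 pi_ge0.
- by move=> _; rewrite lee_fin divr_ge0// mulr_ge0// ltW.
move=> /andP[h1 h2].
have t0 : 0 < t by apply: lt_trans h1; rewrite divr_gt0.
have rt : b <= t.
  by apply/ltW; apply: le_lt_trans h1; rewrite ler_pdivlMr// mulrC.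
apply: (@le_trans _ _ (pi^-1%:E * (c * (t / (2 * b)) ^+ 2)%:E * t^-1%:E)%E).
  rewrite -!EFinM lee_fin.
  rewrite [leRHS](kE t t0).
  by rewrite -mulrA ler_pM2l// ltW.
apply: lee_wpmul2r; first by rewrite lee_fin invr_ge0 ltW.
by apply: lee_wpmul2l; [rewrite lee_fin invr_ge0 pi_ge0|exact: G].
Qed.

End Growth.

(** * Functions of zero area *)
Section Constants.
Variable R : realType.
Local Notation mu := (@lebesgue_measure R).
Local Notation rho := (@spherical_dist R).
Implicit Types (F : merofun R).

(** The complement of the set of constants is open.  Measurability matters:
    a value 0 of the probability makes a set negligible only if the set is
    measurable. *)
Lemma measurable_constants : measurable
  ([set F : borel_merofun R | exists c, forall z, mero_eval F z = c]).
Proof.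
pose C z : set (merofun R) := [set F | rho (F z) (F 0) != 0].
have -> : [set F : borel_merofun R | exists c, forall z, mero_eval F z = c] =
    ~` (\bigcup_z C z).
  apply/seteqP; split => F.
    by move=> [c Fc] [z _]; rewrite /C /= !Fc rhoxx eqxx.
  move=> H; exists (mero_eval F 0) => z; apply/eqP; apply: contraT => ne.
  by exfalso; apply: H; exists z => //; rewrite /C /= gt_eqF// rho_gt0.
apply: measurableC; apply: measurable_open; apply: bigcup_open => z _.
have -> : C z = (fun F : merofun R => rho (F z) (F 0)) @^-1` [set r | 0 < r].
  by apply/seteqP; split => F; rewrite /C /= lt_neqAle rho_ge0 andbT eq_sym.
move/continuousP : (@continuous_rho_eval2 R z 0); apply; exact: open_gt.
Qed.

(** The squares [box k.+1 0 0] cover the plane, so the spherical derivative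
    vanishes almost everywhere for the product measure, and Tonelli turns this
    into almost every point of almost every horizontal line. *)
Lemma area0_constant F : (forall k : nat, area F (box k.+1%:R 0 0) = 0%E) ->
  exists c, forall z, F z = c.
Proof.
move=> H; exists (F 0); apply: ae_affine_sder0_cst.
pose g (p : R * R) : \bar R := (affine_sder F (p.1 +i* p.2) ^+ 2)%:E.
have mg : measurable_fun setT g := measurable_affine_sder2 F.
have g0 p : (0 <= g p)%E by rewrite lee_fin sqr_ge0.
have absg D : (\int[mu \x mu]_(p in D) `|g p| = \int[mu \x mu]_(p in D) g p)%E.
  by apply: eq_integral => p _; rewrite gee0_abs.
have gT : (\int[mu \x mu]_p g p = 0)%E.
  rewrite -absg; apply/ae_eq_integral_abs => //.
  have : (mu \x mu)%E.-negligible
      (\bigcup_k (box k.+1%:R 0 0 `&` [set p | g p <> 0%E])).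
    apply: negligible_bigcup => k.
    have mgk : measurable_fun (box k.+1%:R 0 0) g by exact: measurable_funS mg.
    have [+ _] := @ae_eq_integral_abs _ _ R (mu \x mu)%E (box k.+1%:R 0 0)
      (measurable_box _ _ _) g mgk.
    move=> /(_ (etrans (absg _) (H k))); apply: negligibleS => p [kp gp] /=.
    by move=> /(_ kp).
  apply: negligibleS => p /= /not_implyP[_ gp].
  pose k := Num.truncn (`|p.1| + `|p.2|).
  have pk : `|p.1| + `|p.2| < k.+1%:R by exact: truncnS_gt.
  exists k => //; split => //; rewrite /box /cell /=.
  have := ler_norm p.1; have := ler_norm p.2.
  have := ler_norm (- p.1); have := ler_norm (- p.2).
  have := normr_ge0 p.1; have := normr_ge0 p.2.
  rewrite !normrN => *; rewrite !in_itv/=.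
  by split; apply/andP; split; lra.
have mG := @measurable_fun_fubini_tonelli_G _ _ _ _ R mu g mg g0.
have [+ _] := @ae_eq_integral_abs _ _ R mu setT measurableT (fubini_G mu g) mG.
have G0 y : (0 <= fubini_G mu g y)%E by exact: integral_ge0.
move=> /(_ _)/wrap[].
  rewrite -[RHS]gT (@fubini_tonelli2 _ _ _ _ R mu mu g mg g0).
  by apply: eq_integral => y _; rewrite gee0_abs.
apply: negligibleS => y /=; apply: contra_not => /(_ I) Gy.
have mgy : measurable_fun setT (fun x : R => g (x, y)) by exact: measurable_fun_pair1.
have [+ _] := @ae_eq_integral_abs _ _ R mu setT measurableT (fun x : R => g (x, y)) mgy.
move=> /(_ _)/wrap[].
  by rewrite -[RHS]Gy; apply: eq_integral => x _; rewrite gee0_abs.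
apply: negligibleS => x /=; apply: contra_not => /(_ I).
by rewrite /g /= => -[] /eqP; rewrite sqrf_eq0 => /eqP.
Qed.

End Constants.

(** * Almost sure quadratic growth *)
Section Main.
Variables (R : realType) (lambda : probability (borel_merofun R) R).
Hypothesis lambda_inv : translation_invariant lambda.
Local Notation mu := (@lebesgue_measure R).
Implicit Types (F : borel_merofun R).

Section Scale.
Variables (K : R).
Hypothesis K0 : 0 < K.

Local Notation S := (step_right K : borel_merofun R -> borel_merofun R).
Local Notation T := (step_up K : borel_merofun R -> borel_merofun R).

(** Truncation at 1 makes the area of a square real-valued and keeps it
    positive where it was. *)
Let g F : R := fine (mine (area F (box K 0 0)) 1%E).

Let area_ge0 (F : merofun R) D : (0 <= area F D)%E.
Proof. by apply: integral_ge0 => p _; rewrite lee_fin sqr_ge0. Qed.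

Let gE F : ((g F)%:E = mine (area F (box K 0 0)) 1)%E.
Proof.
rewrite /g fineK// ge0_fin_numE; last by rewrite le_min area_ge0 lee_fin ler01.
by rewrite gt_min ltry orbT.
Qed.

Let g_ge0 F : 0 <= g F.
Proof. by rewrite fine_ge0// le_min area_ge0 lee_fin ler01. Qed.

Let measurable_g : measurable_fun setT g.
Proof.
apply/measurable_EFinP; rewrite (_ : EFin \o g = fun F =>
  mine (area F (box K 0 0)) 1%E); last by apply/funext => F; exact: gE.
apply: measurable_mine; last exact: measurable_cst.
by apply: measurable_area; exact: measurable_box.
Qed.

Let g1 := lower_mean S g.
Let g2 := lower_mean T g1.

Let measurable_S : measurable_fun setT S.
Proof. exact: measurable_translate. Qed.

Let measurable_T : measurable_fun setT T.
Proof. exact: measurable_translate. Qed.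

Let g1_ge0 F : 0 <= g1 F. Proof. exact: lower_mean_ge0. Qed.

Let measurable_g1 : measurable_fun setT g1.
Proof. exact: measurable_lower_mean. Qed.

(** [c] is the value at [F] of the lower mean taken first along horizontal and
    then along vertical steps: [n] times it is at most a sum of [n] horizontal
    lower means, each of which is, up to the factor [n], at most a sum of [n]
    values of [g]. *)
Lemma ae_quadratic_growth : {ae lambda, forall F, area F (box K 0 0) <> 0%E ->
  exists2 c, 0 < c & forall n : nat, ((c * n%:R ^+ 2)%:E <=
    \int[mu \x mu]_(p in [set p : R * R | (normc (p.1 +i* p.2) < n%:R * (4 * K))%R])
      (spherical_derivative F (p.1 +i* p.2) ^+ 2)%:E)%E}.
Proof.
have n1 := lower_mean_eq0_negligible (P := lambda) measurable_S (@lambda_inv _) measurable_g g_ge0.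
have n2 := lower_mean_eq0_negligible (P := lambda) measurable_T (@lambda_inv _) measurable_g1 g1_ge0.
apply: (negligibleS _ (negligibleU n1 n2)) => F /= nF.
have [g10|g10] := pselect (g1 F = 0).
  left; split => //; apply: contra_notP nF => /negP; rewrite -leNgt => gF aF.
  exfalso; apply: aF; apply/eqP; rewrite eq_le area_ge0 andbT.
  have : ((g F)%:E <= 0)%E by rewrite lee_fin.
  by rewrite gE ge_min lee_fin ler10 orbF.
right; split; last by rewrite lt_neqAle g1_ge0 andbT eq_sym; exact/eqP.
apply: contra_notP nF => g20 _; exists (g2 F).
  by rewrite lt_neqAle lower_mean_ge0// andbT eq_sym; exact/eqP.
move=> n; apply: le_trans (sum_area_le F n K0).
apply: (@le_trans _ _
    (\sum_(j < n) \sum_(i < n) g (iter i S (iter j T F)))%:E).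
  rewrite lee_fin expr2 mulrC -mulrA.
  apply: (@le_trans _ _ (n%:R * \sum_(j < n) g1 (iter j T F))).
    by rewrite ler_wpM2l//; exact: lower_mean_le.
  by rewrite mulr_sumr; apply: ler_sum => j _; exact: lower_mean_le.
rewrite -sumEFin; apply: lee_sum => j _; rewrite -sumEFin; apply: lee_sum => i _.
rewrite gE; apply: (@le_trans _ _ (area (iter i S (iter j T F)) (box K 0 0))).
  by rewrite ge_min lexx.
by rewrite area_iter_right area_iter_up !addn0.
Qed.

End Scale.

End Main.

Theorem theorem4 (R : realType) (lambda : probability (borel_merofun R) R)
    (hinv : translation_invariant lambda) (hnt : non_trivial lambda) :
  {ae lambda, forall F : borel_merofun R,
    (0 < limf_einf
           (fun r : R => nevanlinna_characteristic F r * (r ^- 2)%:E)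
           (pinfty_nbhs R))%E}.
Proof.
have K0 (k : nat) : 0 < k.+1%:R :> R by rewrite ltr0n.
have cst0 : lambda.-negligible
    [set F : borel_merofun R | exists c, forall z, mero_eval F z = c].
  by apply/negligibleP; [exact: measurable_constants|exact: hnt].
have := negligible_bigcup (fun k => ae_quadratic_growth hinv (K0 k)).
move=> /(negligibleU cst0); apply: negligibleS => F /=; apply: contra_notP.
move=> /not_orP[Fc Fk].
have [k Ak] : exists k : nat, area F (box k.+1%:R 0 0) <> 0%E.
  by apply: contra_notP Fc => /forallNP H; apply: area0_constant => k; exact: contrapT.
have [c c0 cP] : exists2 c, 0 < c & forall n : nat, ((c * n%:R ^+ 2)%:E <=
    \int[@lebesgue_measure R \x @lebesgue_measure R]_(p in
      [set p : R * R | (normc (p.1 +i* p.2) < n%:R * (4 * k.+1%:R))%R])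
      (spherical_derivative F (p.1 +i* p.2) ^+ 2)%:E)%E.
  by apply: contra_notP Fk => H; exists k => //= /(_ Ak).
by apply: characteristic_liminf_gt0 c0 cP; rewrite mulr_gt0.
Qed.
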